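(* Assume that $\mathbf{U}:\mathbb{R}^{2N}\to\mathbb{R}^{2N}$ is Lipschitz and bounded. Then, for all $T>0$ and all $\mathbf{q}_0\in Q$, the problem $$\frac{d\mathbf{q}}{dt}+\mathcal{N}_{\mathbf{q}}\ni \mathbf{U}(\mathbf{q}),\qquad \mathbf{q}(0)=\mathbf{q}_0,$$ has one and only one absolutely continuous solution $\mathbf{q}(\cdot)$ over $[0,T]$.
   Context: Let $N$ be a positive integer and $r>0$. Configurations are vectors $\mathbf{q}=(q_1,\dots,q_N)\in\mathbb{R}^{2N}$ with $q_i\in\mathbb{R}^2$, and $\mathbb{R}^{2N}$ carries the Euclidean norm. For $i<j$ set $D_{ij}(\mathbf{q})=|q_i-q_j|-2r$, and define the set of feasible configurations $$Q=\{\mathbf{q}\in\mathbb{R}^{2N} : D_{ij}(\mathbf{q})\ge 0\ \ \forall\, i<j\}.$$ For $q_i\ne q_j$ let $e_{ij}(\mathbf{q})=\frac{q_j-q_i}{|q_j-q_i|}$ and let $\mathbf{G}_{ij}(\mathbf{q})=\nabla D_{ij}(\mathbf{q})\in\mathbb{R}^{2N}$, i.e. the vector whose $i$-th $\mathbb{R}^2$-block is $-e_{ij}(\mathbf{q})$, whose $j$-th block is $e_{ij}(\mathbf{q})$, and whose other blocks are $0$. Define the cone of feasible velocities $$\mathcal{C}_{\mathbf{q}}=\{\mathbf{v}\in\mathbb{R}^{2N} : \forall i<j,\ D_{ij}(\mathbf{q})=0\Rightarrow \mathbf{G}_{ij}(\mathbf{q})\cdot\mathbf{v}\ge 0\}$$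 and its polar cone $\mathcal{N}_{\mathbf{q}}=\mathcal{C}_{\mathbf{q}}^\circ=\{\mathbf{w}\in\mathbb{R}^{2N} : \mathbf{w}\cdot\mathbf{v}\le 0\ \ \forall \mathbf{v}\in\mathcal{C}_{\mathbf{q}}\}$. An absolutely continuous solution over $[0,T]$ is an absolutely continuous map $\mathbf{q}:[0,T]\to\mathbb{R}^{2N}$ with $\mathbf{q}(t)\in Q$ for all $t\in[0,T]$, $\mathbf{q}(0)=\mathbf{q}_0$, and $\mathbf{U}(\mathbf{q}(t))-\frac{d\mathbf{q}}{dt}(t)\in\mathcal{N}_{\mathbf{q}(t)}$ for almost every $t\in[0,T]$. *)

(* Defs.v *)
From HB Require Import structures.
From mathcomp Require Import all_boot all_order all_algebra.
From mathcomp Require Import all_classical all_reals all_analysis.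
From mathcomp Require Import ring lra.

Set Implicit Arguments.
Unset Strict Implicit.
Unset Printing Implicit Defensive.

Import Order.TTheory GRing.Theory Num.Theory.
Import numFieldNormedType.Exports.

Local Open Scope ring_scope.
Local Open Scope classical_set_scope.

(* R^(2N) is represented by the N x 2 matrices: row i is the block q_i in R^2.
   The norm `|_| that the library puts on matrices is the sup norm, hence the
   explicit Euclidean structure below. The two norms induce the same topology,
   so the library's derivatives of matrix-valued functions are unaffected. *)

Definition dot {R : realType} {m n : nat} (u v : 'M[R]_(m, n)) : R :=
  \sum_(i < m) \sum_(j < n) u i j * v i j.

Definition enorm {R : realType} {m n : nat} (u : 'M[R]_(m, n)) : R :=
  Num.sqrt (dot u u).

Definition elipschitz {R : realType} {m n : nat}
    (U : 'M[R]_(m, n) -> 'M[R]_(m, n)) : Prop :=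
  exists k : R, forall x y, enorm (U x - U y) <= k * enorm (x - y).

Definition ebounded {R : realType} {m n : nat}
    (U : 'M[R]_(m, n) -> 'M[R]_(m, n)) : Prop :=
  exists M : R, forall x, enorm (U x) <= M.

Definition polar {R : realType} {m n : nat} (K : set 'M[R]_(m, n)) :
    set 'M[R]_(m, n) :=
  [set w | forall v, K v -> dot w v <= 0].

Definition abs_continuous {R : realType} {m n : nat} (a b : R)
    (f : R -> 'M[R]_(m, n)) : Prop :=
  forall e : R, 0 < e -> exists2 d : R, 0 < d &
    forall (p : nat) (x y : 'I_p -> R),
      (forall k, [/\ a <= x k, x k <= y k & y k <= b]) ->
      trivIset [set: 'I_p] (fun k => `]x k, y k[%classic) ->
      \sum_(k < p) (y k - x k) < d ->
      \sum_(k < p) enorm (f (y k) - f (x k)) < e.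

Definition dist {R : realType} {N : nat} (r : R) (i j : 'I_N)
    (q : 'M[R]_(N, 2)) : R :=
  enorm (row i q - row j q) - 2 * r.

Definition feasible {R : realType} {N : nat} (r : R) : set 'M[R]_(N, 2) :=
  [set q | forall i j : 'I_N, (i < j)%N -> 0 <= dist r i j q].

Definition unit_vec {R : realType} {N : nat} (i j : 'I_N) (q : 'M[R]_(N, 2)) :
    'rV[R]_2 :=
  (enorm (row j q - row i q))^-1 *: (row j q - row i q).

Definition grad_dist {R : realType} {N : nat} (i j : 'I_N) (q : 'M[R]_(N, 2)) :
    'M[R]_(N, 2) :=
  \matrix_(k < N) (if k == i then - unit_vec i j q
                   else if k == j then unit_vec i j q else 0).

Definition velocity_cone {R : realType} {N : nat} (r : R) (q : 'M[R]_(N, 2)) :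
    set 'M[R]_(N, 2) :=
  [set v | forall i j : 'I_N, (i < j)%N -> dist r i j q = 0 ->
     0 <= dot (grad_dist i j q) v].

Definition normal_cone {R : realType} {N : nat} (r : R) (q : 'M[R]_(N, 2)) :
    set 'M[R]_(N, 2) :=
  polar (velocity_cone r q).

(* Solutions are total functions of which only the values on [0, T] matter;
   the derivative at an endpoint may depend on the extension, but the
   endpoints form a null set. *)
Definition ac_solution {R : realType} {N : nat} (r : R)
    (U : 'M[R]_(N, 2) -> 'M[R]_(N, 2)) (T : R) (q0 : 'M[R]_(N, 2))
    (q : R -> 'M[R]_(N, 2)) : Prop :=
  [/\ abs_continuous 0 T q,
      forall t : R, 0 <= t <= T -> feasible r (q t),
      q 0 = q0 &
      {ae @lebesgue_measure R, forall t : R, 0 <= t <= T ->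
        derivable q t 1 /\ normal_cone r (q t) (U (q t) - 'D_1 q t)}].

Lemma dot_grad_dist {R : realType} {N : nat} (i j : 'I_N)
    (q v : 'M[R]_(N, 2)) : i != j ->
  dot (grad_dist i j q) v =
    (enorm (row i q - row j q))^-1 * dot (row i q - row j q) (row i v - row j v).
Proof.
move=> ij; have ji : j == i = false by rewrite eq_sym (negbTE ij).
have sy : enorm (row j q - row i q) = enorm (row i q - row j q).
  by rewrite /enorm /dot; congr Num.sqrt; apply: eq_bigr => k _;
    apply: eq_bigr => l _; rewrite !mxE; ring.
rewrite {1}/dot (bigD1 i)//= (bigD1 j)/= 1?ji// [X in _ + (_ + X)]big1 ?addr0.
  rewrite /dot !big_ord_recl !big_ord0 !mxE eqxx ji eqxx !mxE sy.
  by ring.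
move=> k /andP[/negbTE ki /negbTE kj]; apply: big1 => l _.
by rewrite !mxE ki kj mxE mul0r.
Qed.

Lemma is_derive_dist {R : realType} {N : nat} (r : R) (i j : 'I_N)
    (q v : 'M[R]_(N, 2)) : row i q != row j q ->
  is_derive q v (dist r i j) (dot (grad_dist i j q) v).
Proof.
move=> qij; have ij : i != j by apply: contraNneq qij => ->.
set w := row i q - row j q; set d := row i v - row j v.
pose s (h : R) := dot w w + h * (2 * dot w d) + h * h * dot d d.
have wwE : dot w w = w 0 0 ^+ 2 + w 0 1 ^+ 2.
  rewrite /dot big_ord1 !big_ord_recl big_ord0 addr0 !expr2.
  by have -> : lift ord0 ord0 = 1 :> 'I_2 by apply/val_inj.
have ww0 : 0 < dot w w.
  rewrite lt_neqAle wwE addr_ge0 ?sqr_ge0// andbT eq_sym paddr_eq0 ?sqr_ge0//.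
  rewrite !sqrf_eq0; apply: contraNN qij => /andP[/eqP w0 /eqP w1].
  rewrite -subr_eq0; apply/eqP/rowP => k; rewrite -/w [RHS]mxE.
  by case: k => [[|[|//]] hk]; [rewrite -w0|rewrite -w1];
    congr (w _ _); apply/val_inj.
have lineE : (fun h : R => dist r i j (h *: v + q)) =
    (fun h => Num.sqrt (s h) - 2 * r).
  apply/funext => h; rewrite /dist /enorm; congr (Num.sqrt _ - _).
  by rewrite /s /dot !big_ord_recl !big_ord0 /w /d !mxE; ring.
have ds : is_derive (0 : R) (1 : R) s (2 * dot w d).
  by apply: is_derive_eq; rewrite /GRing.scale/=; ring.
have dsq : is_derive (s 0) (1 : R) Num.sqrt (2 * Num.sqrt (s 0))^-1.
  by apply: is_derive1_sqrt; rewrite /s !mul0r !addr0.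
have dcomp := @is_derive1_comp R Num.sqrt s 0 _ _ dsq ds.
have dl : is_derive (0 : R) (1 : R) (fun h => dist r i j (h *: v + q))
    (dot (grad_dist i j q) v).
  rewrite lineE; apply: is_derive_eq.
  rewrite dot_grad_dist// -/w -/d /s !mul0r !addr0 subr0 invfM mulrACA.
  by rewrite mulVf ?pnatr_eq0// mul1r.
have Dl (f : 'M[R]_(N, 2) -> R) : 'D_v f q = 'D_1 (fun h : R => f (h *: v + q)) 0.
  rewrite /derive; set g1 := fun h => h^-1 *: _; set g2 := fun h => h^-1 *: _.
  suff -> : g1 = g2 by [].
  by apply/funext => h; rewrite /g1 /g2/= addr0 scale0r add0r [_%:A]mulr1.
apply: DeriveDef; last by rewrite Dl; exact: derive_val.
by case: dl => dl _; exact: (derivable1P _ _ _).2 dl.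
Qed.

(* Main.v *)
(* Everything is reduced to one inequality.  If w is normal to the feasible set Q
   at q and z is in Q, then w.(z - q) <= |w||q| |z - q|^2 / (4 r^2): the
   constraints are violated by the velocity z - q only at second order, and the
   dilation q increases every contact distance at rate 2 r, so that z - q + s q is
   a feasible velocity for s = |z - q|^2 / (4 r^2).  Thus Q is prox-regular on
   bounded sets, without any estimate on Lagrange multipliers.

   Uniqueness: along a solution U(q) - q' is orthogonal to q', hence bounded by |U|,
   and the inequality gives d/dt |q1 - q2|^2 <= K |q1 - q2|^2 almost everywhere.

   Existence: the catching-up scheme p_(n+1) = P_Q(p_n + h U(p_n)) satisfies a
   discrete evolution variational inequality which only involves two times and a
   fixed z in Q.  It survives the pointwise limit along an ultrafilter of step
   sizes, and it implies the inclusion at every point of differentiability of the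
   (Lipschitz) limit. *)

Require Import Defs.
From HB Require Import structures.
From mathcomp Require Import all_boot all_order all_algebra.
From mathcomp Require Import all_classical all_reals all_analysis.
From mathcomp Require Import ring lra.
Import Order.TTheory GRing.Theory Num.Theory.
Import numFieldNormedType.Exports.
Local Open Scope ring_scope.
Local Open Scope classical_set_scope.

Set Implicit Arguments.
Unset Strict Implicit.
Unset Printing Implicit Defensive.

(** * The Euclidean structure on matrices *)

Lemma cvg_sum_ord {R : realType} {S : Type} (F : set_system S) {FF : Filter F}
    (p : nat) (f : 'I_p -> S -> R) (a : 'I_p -> R) :
  (forall i, f i @ F --> a i) ->
  (fun x => \sum_(i < p) f i x) @ F --> \sum_(i < p) a i.
Proof.
elim: p f a => [|p IHp] f a fa.
  rewrite big_ord0 (_ : (fun _ => _) = cst 0); first exact: cvg_cst.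
  by apply/funext => x; rewrite big_ord0.
rewrite big_ord_recl (_ : (fun _ => _) =
  (fun x => f ord0 x + \sum_(i < p) f (lift ord0 i) x)).
  by apply: cvgD => //; apply: (IHp (fun i => f (lift ord0 i))).
by apply/funext => x; rewrite big_ord_recl.
Qed.

Section euclidean.
Context {R : realType} {m n : nat}.
Implicit Types u v w : 'M[R]_(m, n).

Lemma dotC u v : dot u v = dot v u.
Proof. by apply: eq_bigr => i _; apply: eq_bigr => j _; rewrite mulrC. Qed.

Lemma dotDl u v w : dot (u + v) w = dot u w + dot v w.
Proof.
rewrite /dot -big_split; apply: eq_bigr => i _.
by rewrite -big_split; apply: eq_bigr => j _; rewrite mxE mulrDl.
Qed.

Lemma dotZl a u v : dot (a *: u) v = a * dot u v.
Proof.
rewrite /dot mulr_sumr; apply: eq_bigr => i _.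
by rewrite mulr_sumr; apply: eq_bigr => j _; rewrite mxE mulrA.
Qed.

Lemma dotDr u v w : dot w (u + v) = dot w u + dot w v.
Proof. by rewrite dotC dotDl !(dotC w). Qed.

Lemma dotZr a u v : dot u (a *: v) = a * dot u v.
Proof. by rewrite dotC dotZl dotC. Qed.

Lemma dotNl u v : dot (- u) v = - dot u v.
Proof. by rewrite -scaleN1r dotZl mulN1r. Qed.

Lemma dotNr u v : dot u (- v) = - dot u v.
Proof. by rewrite dotC dotNl dotC. Qed.

Definition dotE := (dotDl, dotDr, dotNl, dotNr, dotZl, dotZr).

Lemma dot_sqrD u v : dot (u + v) (u + v) = dot u u + 2 * dot u v + dot v v.
Proof. by rewrite !dotE (dotC v u); ring. Qed.

Lemma dot_subr_sqr u v : dot u u - dot v v = dot (u - v) (u + v).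
Proof. by rewrite !dotE (dotC v u); ring. Qed.

Lemma dot_ge0 u : 0 <= dot u u.
Proof. by apply: sumr_ge0 => i _; apply: sumr_ge0 => j _; rewrite -expr2 sqr_ge0. Qed.

Lemma dot_eq0 u : dot u u = 0 -> u = 0.
Proof.
move=> uu0; apply/matrixP => i j; rewrite mxE; apply/eqP.
have ge0 k l : 0 <= u k l * u k l by rewrite -expr2 sqr_ge0.
rewrite -sqrf_eq0 expr2; apply/eqP.
have /(_ i isT) := psumr_eq0P (fun k _ => sumr_ge0 _ (fun l _ => ge0 k l)) uu0.
by move=> /(psumr_eq0P (fun l _ => ge0 i l))/(_ j isT).
Qed.

Lemma enorm_ge0 u : 0 <= enorm u. Proof. exact: sqrtr_ge0. Qed.

Lemma sqr_enorm u : enorm u ^+ 2 = dot u u.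
Proof. by rewrite sqr_sqrtr// dot_ge0. Qed.

Lemma enorm_le u a : 0 <= a -> dot u u <= a ^+ 2 -> enorm u <= a.
Proof. by move=> a0; rewrite -sqr_enorm ler_sqr ?nnegrE ?enorm_ge0. Qed.

Lemma enormN u : enorm (- u) = enorm u.
Proof. by rewrite /enorm dotNl dotNr opprK. Qed.

Lemma enormZ a u : enorm (a *: u) = `|a| * enorm u.
Proof. by rewrite /enorm dotZl dotZr mulrA -expr2 sqrtrM ?sqr_ge0// sqrtr_sqr. Qed.

Lemma cauchy_schwarz u v : `|dot u v| <= enorm u * enorm v.
Proof.
rewrite -ler_sqr ?nnegrE ?mulr_ge0 ?enorm_ge0// real_normK ?num_real//.
rewrite exprMn !sqr_enorm.
have [/dot_eq0 ->|v0] := eqVneq (dot v v) 0.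
  by rewrite -(scale0r v) !dotZr !mul0r mulr0 expr0n.
have vgt0 : 0 < dot v v by rewrite lt_neqAle eq_sym v0 dot_ge0.
(* The squared norm of |v|^2 u - (u.v) v equals |v|^2 (|u|^2 |v|^2 - (u.v)^2). *)
have := dot_ge0 (dot v v *: u - dot u v *: v).
rewrite !dotE (dotC v u) => h.
rewrite -subr_ge0 -(pmulr_rge0 _ vgt0); apply: le_trans h _.
by rewrite le_eqVlt; apply/orP; left; apply/eqP; ring.
Qed.

Lemma dot_le u v : dot u v <= enorm u * enorm v.
Proof. exact: le_trans (ler_norm _) (cauchy_schwarz u v). Qed.

Lemma dot_ge u v : - (enorm u * enorm v) <= dot u v.
Proof. by have := cauchy_schwarz u v; rewrite ler_norml => /andP[]. Qed.

Lemma enormD u v : enorm (u + v) <= enorm u + enorm v.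
Proof.
apply: enorm_le; first by rewrite addr_ge0 ?enorm_ge0.
rewrite !dotE (dotC v u) sqrrD !sqr_enorm.
by have := dot_le u v; lra.
Qed.

Lemma enormDB u v w : enorm (u - w) <= enorm (u - v) + enorm (v - w).
Proof. by apply: le_trans (enormD _ _); rewrite subrKA. Qed.

Lemma enorm_coord u i j : `|u i j| <= enorm u.
Proof.
rewrite -ler_sqr ?nnegrE ?enorm_ge0// real_normK ?num_real// sqr_enorm.
rewrite /dot (bigD1 i)//= (bigD1 j)//= -expr2 -addrA lerDl addr_ge0//.
  by apply: sumr_ge0 => k _; rewrite -expr2 sqr_ge0.
by apply: sumr_ge0 => k _; apply: sumr_ge0 => l _; rewrite -expr2 sqr_ge0.
Qed.

Lemma cvg_dot {S : Type} (F : set_system S) {FF : Filter F}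
    (f g : S -> 'M[R]_(m, n)) u v :
  f @ F --> u -> g @ F --> v -> (fun x => dot (f x) (g x)) @ F --> dot u v.
Proof.
move=> fu gv; apply: cvg_sum_ord => i; apply: cvg_sum_ord => j.
apply: cvgM.
  exact: (cvg_comp _ _ fu (@coord_continuous _ _ _ i j u)).
exact: (cvg_comp _ _ gv (@coord_continuous _ _ _ i j v)).
Qed.

Lemma cvg_enorm {S : Type} (F : set_system S) {FF : Filter F}
    (f : S -> 'M[R]_(m, n)) u :
  f @ F --> u -> (fun x => enorm (f x)) @ F --> enorm u.
Proof.
move=> fu; apply: (cvg_comp _ _ (cvg_dot fu fu)).
exact: sqrt_continuous.
Qed.

Lemma cvg_coord {S : Type} (F : set_system S) {FF : Filter F}
    (f : S -> 'M[R]_(m, n)) u :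
  (forall i j, (fun x => f x i j) @ F --> u i j) -> f @ F --> u.
Proof.
move=> fu; apply/cvgrPdist_le => e e0; near=> x.
rewrite /Num.Def.normr/= mx_normrE (bigmax_le _ (ltW e0))//= => i _.
rewrite !mxE; move: i; near: x; apply: filter_forall => /= -[i j].
exact: ((cvgrPdist_le _ _).1 (fu i j)).
Unshelve. all: by end_near. Qed.

(** Each entry is dominated by the Euclidean norm, which therefore controls convergence in the
    topology of the sup norm. *)
Lemma enorm_cvg0 {S : Type} (F : set_system S) {FF : Filter F}
    (f : S -> 'M[R]_(m, n)) u :
  (fun x => enorm (f x - u)) @ F --> 0 -> f @ F --> u.
Proof.
move=> fu; apply: cvg_coord => i j; apply/cvgrPdist_le => e e0.
near=> x; rewrite distrC.
apply: le_trans (_ : enorm (f x - u) <= _).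
  by have := enorm_coord (f x - u) i j; rewrite !mxE.
rewrite -[leLHS]ger0_norm ?enorm_ge0// -normrN -sub0r.
by near: x; move: e e0; exact/cvgrPdist_le.
Unshelve. all: by end_near. Qed.

End euclidean.

Lemma dot_rows {R : realType} {m n : nat} (u v : 'M[R]_(m, n)) :
  dot u v = \sum_(i < m) dot (row i u) (row i v).
Proof.
apply: eq_bigr => i _; rewrite /dot big_ord1.
by apply: eq_bigr => j _; rewrite !mxE.
Qed.

Lemma dot_row_diff {R : realType} {m n : nat} (i j : 'I_m) (u : 'M[R]_(m, n)) :
  i != j ->
  dot (row i u - row j u) (row i u - row j u) <= 2 * dot u u.
Proof.
move=> ij; have h : dot (row i u) (row i u) + dot (row j u) (row j u) <= dot u u.
  rewrite (dot_rows u) (bigD1 i)//= (bigD1 j)//= 1?eq_sym// addrA lerDl.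
  by apply: sumr_ge0 => k _; exact: dot_ge0.
have := dot_ge0 (row i u + row j u).
by rewrite !dotE; move: h; rewrite (dotC (row j u)); lra.
Qed.

(** * Almost everywhere differentiability of Lipschitz functions *)

Section lipschitz_ae.
Context {R : realType}.
Notation mu := (@lebesgue_measure R).

(** Both measures are infima over countable covers by half-open intervals, and on each interval the
    increment of [F] is at most [L] times the length. *)
Lemma lebesgue_stieltjes_dominated (F : cumulative R R) (L : R) :
  0 < L -> (forall x y, x <= y -> F y - F x <= L * (y - x)) ->
  lebesgue_stieltjes_measure F `<< mu.
Proof.
move=> L0 FL; apply/null_content_dominatesP => A mA A0.
suff : (lebesgue_stieltjes_measure F A <= L%:E * mu A)%E.
  by rewrite A0 mule0 => ?; apply/eqP; rewrite eq_le measure_ge0 andbT.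
rewrite -lee_pdivrMl//; apply: le_ereal_inf_tmp => _ [B [mB AB] <-].
rewrite lee_pdivrMl// -nneseriesZl; last by move=> i _; exact: wlength_ge0.
apply: (@le_trans _ _ (\sum_(k <oo) wlength F (B k))%E).
  by apply: ereal_inf_lbound; exists B.
apply: lee_nneseries => k _; first by move=> _; exact: wlength_ge0.
have /ocitvP[->|[x x12 ->]] := mB k.
  by rewrite [X in (_ * X)%E]wlength0 mule0 wlength0.
have x12W := ltW x12.
rewrite [X in (X <= _)%E]wlength_itv_bnd// [X in (_ * X)%E]wlength_itv_bnd//.
rewrite -EFinM lee_fin.
exact: FL.
Qed.

(** The measure of [F] has a Radon-Nikodym density, so [F] is an indefinite integral and Lebesgue
    differentiation applies. Since [F] vanishes on the left half-line, the integral can start at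
    0. *)
Lemma cumulative_bounded_lipschitz_derivable
    (F : cumulativeBounded (0 : R) (1 : R)) (L : R) :
  0 < L -> (forall x y, x <= y -> F y - F x <= L * (y - x)) ->
  (forall x, x <= 0 -> F x = 0) ->
  {ae mu, forall x, 0 < x -> derivable F x 1}.
Proof.
move=> L0 FL F0.
have [f [f0 ffin fint fE]] :=
  @radon_nikodym_sigma_finite _ _ _ mu (lebesgue_stieltjes_measure F)
    (lebesgue_stieltjes_dominated L0 FL).
have FE : F = (fun x => \int[mu]_(t in `]0, x]) (fine (f t)))%R :> (R -> R).
  apply/funext => x; rewrite /Rintegral.
  under eq_integral do rewrite fineK//.
  rewrite -fE; last exact: measurable_itv.
  have [x0|x0] := leP x 0.
    by rewrite F0// set_itv_ge ?measure0// bnd_simp -leNgt.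
  rewrite /= /lebesgue_stieltjes_measure/= /measure_extension.
  rewrite measurable_mu_extE/=; last exact: is_ocitv.
  by rewrite wlength_itv_bnd ?ltW//= (F0 0)// subr0.
have fint' : mu.-integrable [set: R] (EFin \o (fine \o f)).
  by apply: eq_integrable fint => //= x _; rewrite fineK.
have fintI y : mu.-integrable [set` Interval (BRight 0) (BRight y)]
    (EFin \o (fine \o f)).
  by apply: integrableS fint' => //; exact: measurable_itv.
have := FTC1 fintI.
have lf : locally_integrable [set: R] (fine \o f).
  by apply: open_integrable_locally => //; exact: openT.
move=> /(_ lf); apply: filterS; first exact: (ae_filter_ringOfSetsType mu).
move=> x /= + x0.
by rewrite lte_fin => /(_ x0)[+ _]; rewrite FE.
Qed.

(** Projecting time onto [0, T] extends trajectories by constants, so that estimates can be stated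
    for all real times. *)
Definition clamp (T t : R) : R := Num.max 0 (Num.min t T).

Lemma clamp_le0 T t : 0 <= T -> t <= 0 -> clamp T t = 0.
Proof. by move=> T0 t0; rewrite /clamp min_l ?(le_trans t0)// max_l. Qed.

Lemma clamp_ge T t : 0 <= T -> T <= t -> clamp T t = T.
Proof. by move=> T0 tT; rewrite /clamp min_r// max_r. Qed.

Lemma clamp_id T t : 0 <= t <= T -> clamp T t = t.
Proof. by move=> /andP[t0 tT]; rewrite /clamp min_l// max_r. Qed.

Lemma clamp_itv T t : 0 <= T -> 0 <= clamp T t <= T.
Proof. by move=> T0; rewrite /clamp le_max lexx/= ge_max T0 ge_min lexx orbT. Qed.

Lemma clamp_diff T x y : 0 <= T -> x <= y ->
  0 <= clamp T y - clamp T x <= y - x.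
Proof.
rewrite /clamp => T0 xy.
by case: (leP x T) => ?; case: (leP y T) => ?; case: (leP 0 x) => ?;
  case: (leP 0 y) => ?; rewrite ?(max_r T0); apply/andP; split; lra.
Qed.

(** Constancy outside [0, T] supplies the limits at infinity that a distribution function must
    have. *)
Lemma lipschitz_derivable_ae (f : R -> R) (L T : R) : 0 < T ->
  (forall x y, `|f y - f x| <= L * `|y - x|) ->
  (forall x, x <= 0 -> f x = f 0) -> (forall x, T <= x -> f x = f T) ->
  {ae mu, forall x, 0 < x < T -> derivable f x 1}.
Proof.
move=> T0 fL f0 fT.
have L0 : 0 <= L.
  by have := le_trans (normr_ge0 _) (fL 0 1); rewrite subr0 normr1 mulr1.
pose c := clamp T; have T0W := ltW T0.
have c0 t : t <= 0 -> c t = 0 by exact: clamp_le0.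
have cT t : T <= t -> c t = T by exact: clamp_ge.
have cid t : 0 < t < T -> c t = t.
  by move=> /andP[? ?]; apply: clamp_id; rewrite !ltW.
have clip x y : x <= y -> 0 <= c y - c x <= y - x by exact: clamp_diff.
have ndc x y : x <= y -> 0 <= c y - c x by move=> /clip /andP[].
have lec x y : x <= y -> c y - c x <= y - x by move=> /clip /andP[].
have fc t : f t = f (c t).
  have [t0|t0] := leP t 0; first by rewrite c0// f0.
  have [tT|tT] := leP T t; first by rewrite cT// fT.
  by rewrite cid// t0.
(* Adding (L + 1) id to f and normalizing yields the distribution function of a
   probability measure dominated by the Lebesgue measure. *)
pose K := f T - f 0 + (L + 1) * T.
have K0 : 0 < K.
  have := fL 0 T; rewrite subr0 (gtr0_norm T0) ler_norml => /andP[].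
  by rewrite /K; lra.
pose g t := (f t - f 0 + (L + 1) * c t) / K.
(* The slope L + 1 outweighs any decrease of [f], whose rate is at most L; the two rates add up to 2
   L + 1. *)
have gB x y : x <= y -> 0 <= g y - g x <= (2 * L + 1) / K * (y - x).
  move=> xy; have -> : g y - g x = (f y - f x + (L + 1) * (c y - c x)) / K.
    by rewrite /g; ring.
  have := fL (c x) (c y); rewrite -!fc (ger0_norm (ndc _ _ xy)) ler_norml.
  move=> /andP[h1 h2]; apply/andP; split.
    apply: divr_ge0; last exact: ltW.
    have := ndc _ _ xy; lra.
  rewrite mulrAC ler_pM2r ?invr_gt0//.
  have := lec _ _ xy; have := ndc _ _ xy; nra.
have gnd : nondecreasing g.
  by move=> x y /gB /andP[]; rewrite subr_ge0.
have g0 x : x <= 0 -> g x = 0 by move=> x0; rewrite /g f0// c0// subrr mulr0 addr0 mul0r.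
have gT x : T <= x -> g x = 1.
  by move=> x0; rewrite /g fT// cT// -/K divff// gt_eqF.
have L'0 : 0 < (2 * L + 1) / K by rewrite divr_gt0//; lra.
have grc : right_continuous g.
  apply: right_continuousW => x; apply/cvgrPdist_le => e e0.
  near=> y.
  have yx : `|x - y| <= e / ((2 * L + 1) / K).
    near: y; exists (e / ((2 * L + 1) / K)); first by rewrite /= divr_gt0.
    by move=> z /= /ltW.
  rewrite ler_pdivlMr// mulrC in yx.
  apply: le_trans yx; have [xy|/ltW xy] := leP x y.
    have /andP[? ?] := gB _ _ xy.
    by rewrite distrC ger0_norm// distrC ger0_norm// subr_ge0.
  have /andP[? ?] := gB _ _ xy.
  by rewrite ger0_norm// ger0_norm// subr_ge0.
have gNy : g @ -oo --> (0 : R).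
  apply: cvg_near_cst; exists 0; split=> [|x]; first exact: num_real.
  by move=> /ltW; exact: g0.
have gy : g @ +oo --> (1 : R).
  apply: cvg_near_cst; exists T; split=> [|x]; first exact: num_real.
  by move=> /ltW; exact: gT.
pose H1 := isCumulative.Build R _ R g gnd grc.
pose H2 := isCumulativeBounded.Build R 0 1 g gNy gy.
pose G : cumulativeBounded (0 : R) (1 : R) := HB.pack g H1 H2.
have := @cumulative_bounded_lipschitz_derivable G _ L'0
  (fun x y xy => proj2 (andP (gB x y xy))) g0.
apply: filterS; first exact: (ae_filter_ringOfSetsType mu).
move=> x /= gx /andP[x0 xT].
(* [f] is recovered from [g]; at an interior point [clamp] is locally the identity, so the
   correction is derivable there. *)
have -> : f = (fun t => K * g t + (f 0 - (L + 1) * c t)).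
  by apply/funext => t; rewrite /g mulrC divfK ?gt_eqF//; ring.
apply: derivableD; first by apply: derivableM => //; exact: gx.
apply: derivableB => //; apply: derivableM => //.
apply: (@near_eq_derivable _ _ _ id) => //.
by near=> t; rewrite cid//; apply/andP; split; near: t; [exact: lt_nbhsr|exact: lt_nbhsl].
Unshelve. all: by end_near. Qed.
End lipschitz_ae.

(** * A Gronwall lemma for absolutely continuous functions *)

Section gronwall.
Context {R : realType}.
Notation mu := (@lebesgue_measure R).

(** Consider the supremum of the initial segments on which [P] holds: the second clause puts the
    supremum itself in [P], and the third one moves past it unless it is T. *)
Lemma real_induction (T : R) (P : R -> Prop) : P 0 ->
  (forall c, 0 < c <= T -> (forall s, 0 <= s < c -> P s) -> P c) ->
  (forall c, 0 <= c < T -> P c -> \forall s \near c^'+, P s) ->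
  forall t, 0 <= t <= T -> P t.
Proof.
move=> P0 Pl Pr.
have [T0|T0] := ltP T 0; first by move=> t /andP[]; lra.
pose S := [set c | 0 <= c <= T /\ forall s, 0 <= s <= c -> P s].
have S0 : S 0.
  by rewrite /S/= lexx T0; split => // s s0; rewrite -(le_anti s0).
have ubS : ubound S T by move=> x [/andP[]].
have hS : has_sup S by split; [exists 0|exists T].
have c0 : 0 <= sup S by apply: ub_le_sup => //; exists T.
have cT : sup S <= T by apply: ge_sup => //; exists 0.
have Plt s : 0 <= s < sup S -> P s.
  move=> /andP[s0 sc].
  have : 0 < sup S - s by rewrite subr_gt0.
  move=> /sup_adherent/(_ hS)[x [_ Sx]]; rewrite subKr => sx.
  by apply: Sx; rewrite s0 ltW.
have Pc : P (sup S).
  move: c0; rewrite le_eqVlt => /predU1P[<-//|c0].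
  by apply: Pl => //; rewrite c0.
have cTE : sup S = T.
  apply/eqP; rewrite eq_le cT leNgt; apply/negP => ltcT.
  have /= [h /= h0 hP] : \forall s \near (sup S)^'+, P s.
    by apply: Pr => //; rewrite c0.
  pose c' := Num.min (sup S + h / 2) T.
  have cc' : sup S < c' by rewrite lt_min ltcT andbT ltrDl divr_gt0.
  have : S c'.
    split; first by rewrite (le_trans c0 (ltW cc')) ge_min lexx orbT.
    move=> s /andP[s0 sc'].
    have [ltcs|ltsc|<-//] := ltgtP (sup S) s; last by apply: Plt; rewrite s0.
    apply: hP => //=; rewrite ltr0_norm ?subr_lt0// opprB ltrBlDl.
    rewrite (le_lt_trans sc')// gt_min ltrD2l; apply/orP; left.
    by rewrite ltr_pdivrMr// mulr2n mulrDr mulr1 ltrDl.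
  move=> /(ub_le_sup (ex_intro _ _ ubS)).
  by rewrite leNgt cc'.
move=> t /andP[t0 tT]; move: tT; rewrite le_eqVlt => /predU1P[->|tT].
  by move: Pc; rewrite cTE.
by apply: Plt; rewrite t0 cTE.
Qed.

Lemma sum_disjoint_itv_le (V : set R) (p : nat) (x y : 'I_p -> R) (d : R) :
  measurable V -> (mu V < d%:E)%E ->
  (forall k, x k <= y k) -> (forall k, `]x k, y k[ `<=` V) ->
  trivIset [set: 'I_p] (fun k => `]x k, y k[%classic) ->
  \sum_(k < p) (y k - x k) < d.
Proof.
move=> mV Vd xy xyV txy; rewrite -lte_fin; apply: le_lt_trans Vd.
rewrite -sumEFin.
have -> : (\sum_(k < p) (y k - x k)%:E = \sum_(k < p) mu `]x k, y k[%classic)%E.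
  apply: eq_bigr => k _; rewrite lebesgue_measure_itv/= lte_fin.
  case: ifPn => [_|]; first by rewrite EFinB.
  by rewrite -leNgt => yx; rewrite (@le_anti _ _ (x k) (y k)) ?subrr// xy.
rewrite -measure_bigsetU_ord//.
apply: le_measure; rewrite ?inE//.
  by apply: bigsetU_measurable => k _; exact: measurable_itv.
elim/big_ind: _ => [|C D CV DV|k _].
- exact: sub0set.
- by rewrite subUset.
- exact: xyV.
Qed.

(** The differential inequality is only known almost everywhere, and real induction must cross every
    point. The exceptional null set is enclosed in an open set [V] so small that absolute continuity
    bounds the variation of [f] on it by e. The majorant exp(K t) (e t + [Var t]) then grows fast
    enough both inside and outside [V], and e is arbitrary. *)
Lemma ac_gronwall (f : R -> R) (K T : R) : 0 <= K ->
  (forall e, 0 < e -> exists2 d, 0 < d &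
    forall (p : nat) (x y : 'I_p -> R),
      (forall k, [/\ 0 <= x k, x k <= y k & y k <= T]) ->
      trivIset [set: 'I_p] (fun k => `]x k, y k[%classic) ->
      \sum_(k < p) (y k - x k) < d ->
      \sum_(k < p) `|f (y k) - f (x k)| < e) ->
  f 0 = 0 ->
  {ae mu, forall t, 0 < t < T -> forall e, 0 < e ->
    \forall h \near 0^'+, f (t + h) - f t <= h * (K * f t + e)} ->
  forall t, 0 <= t <= T -> f t <= 0.
Proof.
move=> K0 fac f0 [A [mA A0 PA]].
suff fe e : 0 < e -> forall t, 0 <= t <= T -> f t <= expR (K * t) * (e * t + e).
  move=> t /[dup] t0T /andP[t0 tT]; rewrite leNgt; apply/negP => ft.
  have D0 : 0 < expR (K * t) * (t + 1) by rewrite mulr_gt0 ?expR_gt0// ltr_wpDl.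
  (* This value of e makes the bound equal to f t / 2, which contradicts 0 < f t. *)
  have := fe (f t / (expR (K * t) * (t + 1)) / 2).
  rewrite !divr_gt0// => /(_ isT t t0T).
  set e := _ / 2; have -> : expR (K * t) * (e * t + e) = f t / 2.
    by rewrite /e; field; rewrite !gt_eqF ?expR_gt0 ?ltr_wpDl.
  lra.
move=> e0; have [d d0 fd] := fac _ e0.
(* The inequality is assumed on the open interval only, so 0 is counted among the exceptional
   points. *)
pose NA := A `|` [set 0].
have mNA : measurable NA by apply: measurableU.
have muNA0 : mu NA = 0.
  apply/eqP; rewrite eq_le measure_ge0 andbT.
  have A0' : mu A = 0%E := A0.
  apply: (le_trans (measureU2 _ mA (measurable_set1 0))).
  have S0 : mu [set (0 : R)] = 0%E by exact: lebesgue_measure_set1.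
  rewrite -[leRHS]adde0; apply: leeD; first by move: A0' => /= ->.
  by move: S0 => /= ->.
have [V [oV NAV Vd']] : exists V, [/\ open V, NA `<=` V & (mu (V `\` NA) < d%:E)%E].
  by apply: lebesgue_regularity_outer => //; move: muNA0 => /= ->; rewrite ltry.
have mV : measurable V by exact: measurable_realfun.open_measurable.
have Vd : (mu V < d%:E)%E.
  apply: le_lt_trans Vd'.
  rewrite -{1}(setDUK NAV) (le_trans (measureU2 _ _ _))//; first exact: measurableD.
  rewrite -[leRHS]add0e; apply: leeD => //.
  by move: muNA0 => /= ->.
pose W t := [set v | exists p (x y : 'I_p -> R),
  [/\ forall k, [/\ 0 <= x k, x k <= y k & y k <= t],
     forall k, `]x k, y k[ `<=` V,
     trivIset [set: 'I_p] (fun k => `]x k, y k[%classic) &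
     v = \sum_(k < p) `|f (y k) - f (x k)| ]].
have Wn0 t : W t !=set0.
  exists 0; exists 0, (fun=> 0), (fun=> 0); split => [[]//|[]//|[]//|].
  by rewrite big_ord0.
have We t : t <= T -> ubound (W t) e.
  move=> tT _ [p [x [y [xy xyV txy ->]]]]; apply/ltW/fd => //.
    by move=> k; have [? ? ?] := xy k; split => //; exact: le_trans tT.
  apply: sum_disjoint_itv_le mV Vd _ xyV txy.
  by move=> k; have [] := xy k.
(* The variation of f on V below t: it is at most e, and it absorbs the increments
   of f near the exceptional points, where nothing is known about f. *)
pose Var t := sup (W t).
have Var0 t : t <= T -> 0 <= Var t.
  move=> tT; apply: ub_le_sup; first by exists e; exact: We.
  exists 0, (fun=> 0), (fun=> 0); split => [[]//|[]//|[]//|].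
  by rewrite big_ord0.
have Vare t : t <= T -> Var t <= e by move=> tT; apply: ge_sup => //; exact: We.
have Varle t s : t <= s -> s <= T -> Var t <= Var s.
  move=> ts sT; apply: ge_sup => // v [p [x [y [xy xyV txy ->]]]].
  apply: ub_le_sup; first by exists e; exact: We.
  exists p, x, y; split => // k.
  by have [? ? ?] := xy k; split => //; exact: le_trans ts.
have Varstep t s : 0 <= t -> t <= s -> s <= T -> `]t, s[ `<=` V ->
    Var t + `|f s - f t| <= Var s.
  move=> t0 ts sT tsV; rewrite -lerBrDr; apply: ge_sup => // v.
  move=> [p [x [y [xy xyV txy ->]]]]; rewrite lerBrDr.
  apply: ub_le_sup; first by exists e; exact: We.
  (* The interval ]t, s[ is put in front of a family that lies below t, which gives a family below
     s. *)
  pose ext (a : R) (u : 'I_p -> R) (k : 'I_p.+1) := oapp u a (unlift ord0 k).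
  have ext0 a u : ext a u ord0 = a by rewrite /ext unlift_none.
  have extS a u k : ext a u (lift ord0 k) = u k by rewrite /ext liftK.
  have disj j z : `]x j, y j[%classic z -> `]t, s[%classic z -> False.
    rewrite /= !in_itv/= => /andP[_ zy] /andP[tz _].
    by have [_ _] := xy j; rewrite leNgt (lt_trans tz zy).
  exists p.+1, (ext t x), (ext s y); split.
  - move=> k; case: (unliftP ord0 k) => [j|] ->; rewrite ?ext0 ?extS//.
    by have [? ? ?] := xy j; split => //; exact: le_trans ts.
  - by move=> k; case: (unliftP ord0 k) => [j|] ->; rewrite ?ext0 ?extS.
  - move=> i j _ _; case: (unliftP ord0 i) => [i'|] ->;
      case: (unliftP ord0 j) => [j'|] ->; rewrite ?ext0 ?extS//.
    + by move=> ij; congr lift; exact: txy.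
    + by move=> [z [/disj]].
    + by move=> [z [? /disj]].
  - by rewrite big_ord_recl !ext0 addrC; congr +%R; apply: eq_bigr => k _; rewrite !extS.
pose B t := expR (K * t) * (e * t + Var t).
suff fB : forall t, 0 <= t <= T -> f t <= B t.
  move=> t /[dup] /andP[t0 tT] /fB/le_trans; apply.
  by rewrite ler_wpM2l ?expR_ge0// lerD2l Vare.
have Bin t : 0 <= t <= T -> 0 <= e * t + Var t.
  by move=> /andP[t0 tT]; rewrite addr_ge0 ?Var0// mulr_ge0// ltW.
move=> t /[dup] t0T /andP[t0 tT]; have T0 := le_trans t0 tT.
move: t t0T {t0 tT}; apply: real_induction.
- by rewrite f0 /B mulr_ge0 ?expR_ge0// Bin// lexx.
(* Families of one interval give the left continuity of [f] at c; since [B] is nondecreasing, the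
   bound passes to c. *)
- move=> c /andP[c0 cT] fB; apply/ler_addgt0Pr => eta eta0.
  have [d' d'0 fd'] := fac _ eta0.
  pose s := Num.max 0 (c - d' / 2).
  have s0 : 0 <= s by rewrite le_max lexx.
  have sc : s < c by rewrite gt_max c0 ltrBlDr ltrDl divr_gt0.
  have csd : c - s < d'.
    have : c - d' / 2 <= s by rewrite le_max lexx orbT.
    lra.
  have : f c - f s < eta.
    have := fd' 1%N (fun=> s) (fun=> c); rewrite !big_ord1 => h.
    apply: le_lt_trans (ler_norm _) (h _ _ csd) => //.
      by move=> _; split => //; exact: ltW.
    by move=> i j _ _ _; rewrite !ord1.
  rewrite ltrBlDl => /ltW/le_trans; apply.
  rewrite lerD2r (le_trans (fB s _)) ?s0//.
  rewrite /B ler_pM ?expR_ge0//.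
  + by rewrite Bin// s0 (le_trans (ltW sc)).
  + by rewrite ler_expR ler_wpM2l// ltW.
  + by rewrite lerD ?Varle ?ler_wpM2l// ltW.
- move=> c /andP[c0 cT] fBc.
  have Bc0 : 0 <= e * c + Var c by rewrite Bin// c0 ltW.
  have [Vc|nVc] := pselect (V c).
  (* Inside [V] nothing is known about the slope of [f]; its increment is charged to [Var]. *)
  + have /= [h /= h0 hV] : nbhs c V by exact: open_nbhs_nbhs.
    near=> s.
    have cs : c < s by near: s; exact: nbhs_right_gt.
    have sT : s <= T by near: s; exact: nbhs_right_le.
    have csh : s < c + h by near: s; apply: nbhs_right_lt; rewrite ltrDl.
    have := Varstep c s c0 (ltW cs) sT.
    have csV : `]c, s[ `<=` V.
      move=> z /=; rewrite in_itv/= => /andP[cz zs]; apply: hV => /=.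
      rewrite ltr0_norm ?subr_lt0// opprB ltrBlDl; exact: lt_trans csh.
    move=> /(_ csV) step.
    have : f s <= B c + `|f s - f c|.
      by have := ler_norm (f s - f c); lra.
    move=> /le_trans; apply; rewrite /B.
    have E1 : 1 <= expR (K * c) by rewrite -expR0 ler_expR mulr_ge0.
    have E2 : expR (K * c) <= expR (K * s) by rewrite ler_expR ler_wpM2l// ltW.
    have n0 := normr_ge0 (f s - f c).
    have ecs : e * c <= e * s by rewrite ler_wpM2l// ltW.
    apply: (@le_trans _ _ (expR (K * s) * (e * c + Var c + `|f s - f c|))).
      rewrite [leRHS]mulrDr lerD ?ler_wpM2r// ler_peMl//.
      exact: le_trans E2.
    by rewrite ler_wpM2l ?expR_ge0//; lra.
  (* Outside [V] the differential inequality is available: its term in K is absorbed by 1 + K (s -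
     c) <= exp(K (s - c)), and its slack e by the term e t of the majorant. *)
  + have nNAc : ~ NA c by move=> /NAV.
    have cgt0 : 0 < c.
      by rewrite lt_neqAle c0 andbT; apply/eqP => c0'; apply: nNAc; right.
    have Pc : 0 < c < T -> forall e, 0 < e ->
        \forall h \near 0^'+, f (c + h) - f c <= h * (K * f c + e).
      by apply: contrapT => nP; apply: nNAc; left; apply: PA.
    have [h /= h0 hP] := Pc (introT andP (conj cgt0 cT)) e e0.
    near=> s.
    have cs : c < s by near: s; exact: nbhs_right_gt.
    have sT : s <= T by near: s; exact: nbhs_right_le.
    have csh : s < c + h by near: s; apply: nbhs_right_lt; rewrite ltrDl.
    have := hP (s - c); rewrite /= sub0r normrN gtr0_norm ?subr_gt0//.
    rewrite ltrBlDl => /(_ csh cs); rewrite subrKC => fs.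
    have Vcs : Var c <= Var s by rewrite Varle// ltW.
    have sc0 : 0 < s - c by rewrite subr_gt0.
    have E1 : 1 <= expR (K * s).
      by rewrite -expR0 ler_expR mulr_ge0// ltW// (le_lt_trans c0).
    have ES : expR (K * s) = expR (K * c) * expR (K * (s - c)).
      by rewrite -expRD -mulrDr subrKC.
    have E2 := expR_ge1Dx (K * (s - c)).
    apply: (@le_trans _ _ (B c * (1 + K * (s - c)) + (s - c) * e)).
      have : f c * (1 + K * (s - c)) <= B c * (1 + K * (s - c)).
        by rewrite ler_wpM2r// addr_ge0// mulr_ge0// ltW.
      by move: fs; lra.
    apply: (@le_trans _ _ (expR (K * s) * (e * c + Var c) + expR (K * s) * ((s - c) * e))).
      apply: lerD; last by rewrite ler_peMl// mulr_ge0 ?ltW.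
      by rewrite ES /B -!mulrA ler_wpM2l ?expR_ge0// [leRHS]mulrC ler_wpM2l.
    by rewrite -mulrDr ler_wpM2l ?expR_ge0//; lra.
Unshelve. all: by end_near. Qed.
End gronwall.

(** * Prox-regularity of the feasible set *)

Section cones.
Context {R : realType} {N : nat} (r : R).
Hypothesis r0 : 0 < r.
Implicit Types q v w z : 'M[R]_(N, 2).
Let sep (i j : 'I_N) q : 'rV[R]_2 := row i q - row j q.

Let sepD i j q v : sep i j (q + v) = sep i j q + sep i j v.
Proof. by apply/rowP => k; rewrite !mxE; ring. Qed.

Let sepZ i j a q : sep i j (a *: q) = a *: sep i j q.
Proof. by apply/rowP => k; rewrite !mxE; ring. Qed.

Lemma dist_ge0 (i j : 'I_N) q :
  (0 <= dist r i j q) = (4 * r ^+ 2 <= dot (row i q - row j q) (row i q - row j q)).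
Proof.
rewrite /dist subr_ge0 -ler_sqr ?nnegrE ?enorm_ge0//; last by rewrite mulr_ge0// ltW.
by rewrite sqr_enorm exprMn; congr (_ * _ <= _); rewrite -natrX.
Qed.

Lemma dist_eq0 (i j : 'I_N) q : dist r i j q = 0 ->
  dot (row i q - row j q) (row i q - row j q) = 4 * r ^+ 2.
Proof.
move=> /eqP; rewrite /dist subr_eq0 => /eqP h; rewrite -sqr_enorm h exprMn.
by rewrite -natrX.
Qed.

Lemma velocity_coneP q v : velocity_cone r q v <->
  forall i j : 'I_N, (i < j)%N -> dist r i j q = 0 ->
    0 <= dot (row i q - row j q) (row i v - row j v).
Proof.
have h (i j : 'I_N) : (i < j)%N -> dist r i j q = 0 ->
    (0 <= dot (grad_dist i j q) v) = (0 <= dot (row i q - row j q) (row i v - row j v)).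
  move=> ij d0; rewrite dot_grad_dist; last by apply: contraTneq ij => ->; rewrite ltnn.
  rewrite pmulr_rge0// invr_gt0.
  by move: d0 => /eqP; rewrite /dist subr_eq0 => /eqP ->; rewrite mulr_gt0.
by split => qv i j ij d0; [rewrite -h//|rewrite h//]; exact: qv.
Qed.

(** Feasible velocities need no second-order correction. For a pair in contact, |a + t b|^2 = 4 r^2
    + 2 t a.b + t^2 |b|^2, and the last two terms are nonnegative. A pair not in contact stays apart
    for small t by the triangle inequality, and there are finitely many pairs. *)
Lemma feasible_near q v : feasible r q -> velocity_cone r q v ->
  \forall t \near 0^'+, feasible r (q + t *: v).
Proof.
move=> Qq /velocity_coneP Cv.
suff h (ij : 'I_N * 'I_N) : \forall t \near 0^'+, (ij.1 < ij.2)%N ->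
    0 <= dist r ij.1 ij.2 (q + t *: v).
  near=> t => i j ij.
  suff : forall ij : 'I_N * 'I_N, (ij.1 < ij.2)%N ->
    0 <= dist r ij.1 ij.2 (q + t *: v) by move=> /(_ (i, j)); exact.
  by near: t; apply: filter_forall; exact: h.
case: ij => i j /=; have [ij|_] := ltnP i j; last by near=> t.
set a := sep i j q; set b := sep i j v.
have [d0|d0] := eqVneq (dist r i j q) 0.
  near=> t => _; rewrite dist_ge0 -/(sep i j _) sepD sepZ -/a -/b.
  have t0 : 0 <= t by near: t; exact: nbhs_right_ge.
  rewrite dot_sqrD !(dotZl, dotZr) {1 2}/a /sep dist_eq0// -/(sep i j q).
  have := mulr_ge0 t0 (Cv i j ij d0); have := mulr_ge0 (mulr_ge0 t0 t0) (dot_ge0 b).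
  rewrite -/(sep i j q) -/(sep i j v) -/a -/b; lra.
have dgt : 0 < dist r i j q by rewrite lt_neqAle eq_sym d0 Qq.
near=> t => _.
have t0 : 0 <= t by near: t; exact: nbhs_right_ge.
have tb : t * (enorm b + 1) <= dist r i j q.
  rewrite -ler_pdivlMr ?ltr_wpDl ?enorm_ge0//.
  by near: t; apply: nbhs_right_le; rewrite divr_gt0// ltr_wpDl ?enorm_ge0.
rewrite /dist -/(sep i j _) sepD sepZ -/a -/b.
have := enormD (a + t *: b) (- (t *: b)); rewrite addrK enormN enormZ ger0_norm//.
move: tb; rewrite /dist -/(sep i j q) -/a; lra.
Unshelve. all: by end_near. Qed.

(** Proximal normals are normals: test the inequality at z = q + t v, divide by t and let t tend to
    0, so that the quadratic term disappears whatever [c] is. *)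
Lemma prox_normal_cone (c : R) q w : feasible r q ->
  (forall z, feasible r z -> dot w (z - q) <= c * dot (z - q) (z - q)) ->
  normal_cone r q w.
Proof.
move=> Qq wq v Cv; rewrite leNgt; apply/negP => wv.
have /= h := feasible_near Qq Cv.
have D0 : 0 < `|c| * dot v v + 1 by rewrite ltr_wpDl// mulr_ge0 ?dot_ge0.
near (0 : R)^'+ => t.
have t0 : 0 < t by near: t; exact: nbhs_right_gt.
have Qt : feasible r (q + t *: v) by near: t.
have := wq _ Qt; rewrite (addrC q) addrK !(dotZl, dotZr); apply/negP.
rewrite -ltNge.
have : t * (`|c| * dot v v + 1) < dot w v.
  by rewrite -ltr_pdivlMr//; near: t; apply: nbhs_right_lt; rewrite divr_gt0.
rewrite -(ltr_pM2l t0); apply: le_lt_trans.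
rewrite mulrCA ler_pM2l// mulrCA ler_pM2l//.
have := ler_wpM2r (dot_ge0 v) (ler_norm c); lra.
Unshelve. all: by end_near. Qed.

Lemma normal_cone_hypomonotone q z w : feasible r q -> feasible r z ->
  normal_cone r q w ->
  dot w (z - q) <= enorm w * enorm q / (4 * r ^+ 2) * dot (z - q) (z - q).
Proof.
move=> Qq Qz Nw; set d := z - q.
have r2 : 0 < 4 * r ^+ 2 by rewrite mulr_gt0// exprn_gt0.
(* The dilation q moves apart every pair in contact at rate 2 r. *)
pose s := dot d d / (4 * r ^+ 2).
have s0 : 0 <= s by rewrite divr_ge0 ?dot_ge0// ltW.
have /Nw : velocity_cone r q (d + s *: q).
  apply/velocity_coneP => i j ij d0.
  rewrite -!/(sep i j _) sepD sepZ dotDr dotZr {2 3}/sep dist_eq0//.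
  rewrite /s divfK ?gt_eqF//.
  have ij' : i != j by apply: contraTneq ij => ->; rewrite ltnn.
  (* Feasibility of z gives (sep q).(sep d) >= - |sep d|^2 / 2 >= - |d|^2, and the dilation
     contributes exactly s 4 r^2 = |d|^2. *)
  have := dot_row_diff d ij'; rewrite -/(sep i j d).
  have := Qz i j ij; rewrite dist_ge0 -/(sep i j z).
  have -> : sep i j z = sep i j q + sep i j d by rewrite -sepD subrKC.
  rewrite dot_sqrD {1 2}/sep dist_eq0// -/(sep i j q); lra.
rewrite dotDr dotZr.
have : s * - (enorm w * enorm q) <= s * dot w q by rewrite ler_wpM2l ?dot_ge.
have -> : enorm w * enorm q / (4 * r ^+ 2) * dot d d = s * (enorm w * enorm q).
  by rewrite /s; ring.
lra.
Qed.

End cones.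

(** * Uniqueness *)

Lemma derivable_quotient {R : realType} {m n : nat} (q : R -> 'M[R]_(m, n)) (t : R) :
  derivable q t 1 ->
  (fun h => h^-1 *: (q (t + h) - q t)) @ 0^' --> 'D_1 q t.
Proof.
move=> qt; rewrite (_ : (fun h => _) = (fun h => h^-1 *: (q (h *: 1 + t) - q t))).
  exact: qt.
by apply/funext => h; rewrite [_%:A]mulr1 (addrC h).
Qed.

(** Cut [0, T] into steps of length d / 2, where d is the modulus for the tolerance 1: each step
    raises the norm by at most 1. *)
Lemma abs_continuous_bounded {R : realType} {m n : nat} (T : R)
    (q : R -> 'M[R]_(m, n)) :
  abs_continuous 0 T q -> exists rho, forall t, 0 <= t <= T -> enorm (q t) <= rho.
Proof.
move=> /(_ 1 ltr01)[d d0 qd].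
have step x y : 0 <= x -> x <= y -> y <= T -> y - x < d ->
    enorm (q y) <= enorm (q x) + 1.
  move=> x0 xy yT yxd; have := qd 1%N (fun=> x) (fun=> y); rewrite !big_ord1.
  move=> h; have {}h : enorm (q y - q x) < 1.
    by apply: h => // i j _ _ _; rewrite !ord1.
  by have := enormD (q y - q x) (q x); rewrite subrK; lra.
have bnd k t : 0 <= t <= T -> t <= k%:R * (d / 2) -> enorm (q t) <= enorm (q 0) + k%:R.
  elim: k t => [|k IHk] t /andP[t0 tT].
    by rewrite mul0r => t0'; rewrite addr0 (@le_anti _ _ t 0)// t0 t0'.
  rewrite -natr1 mulrDl mul1r => tk.
  pose s := Num.max 0 (t - d / 2).
  have s0 : 0 <= s by rewrite le_max lexx.
  have st : s <= t by rewrite ge_max t0/= gerBl divr_ge0// ltW.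
  have ts : t - s < d.
    have : t - d / 2 <= s by rewrite le_max lexx orbT.
    lra.
  have sk : s <= k%:R * (d / 2).
    have d20 : 0 <= d / 2 by rewrite divr_ge0// ltW.
    by rewrite ge_max mulr_ge0//=; lra.
  have := IHk s; rewrite s0 (le_trans st tT) => /(_ isT sk).
  by have := step s t s0 st tT ts; lra.
exists (enorm (q 0) + (Num.bound (T / (d / 2)))%:R) => t /andP[t0 tT].
apply: le_trans (bnd (Num.bound (T / (d / 2))) t _ _) _ => //.
  by rewrite t0.
rewrite -ler_pdivrMr ?divr_gt0//.
apply: (@le_trans _ _ (T / (d / 2))); first by rewrite ler_wpM2r// invr_ge0 divr_ge0 ?ltW.
by rewrite ltW// archi_boundP// !divr_ge0// ?(le_trans t0 tT)// ltW.
Qed.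

Lemma cvg_dnbhs0 {R : realType} : (fun h : R => h) @ 0^' --> (0 : R).
Proof. by move=> A; exact: nbhs_dnbhs. Qed.

Section uniqueness.
Context {R : realType} {N : nat} (r : R).
Hypothesis r0 : 0 < r.
Variables (U : 'M[R]_(N, 2) -> 'M[R]_(N, 2)) (T : R).

(** Test hypomonotonicity at z = q (t + h) and divide by h: the quadratic term is of order h after
    the division. Positive h gives one inequality and negative h the opposite one. *)
Lemma normal_cone_velocity_orth (q : R -> 'M[R]_(N, 2)) (t : R) w :
  (forall s, 0 <= s <= T -> feasible r (q s)) -> 0 < t < T ->
  derivable q t 1 -> normal_cone r (q t) w -> dot w ('D_1 q t) = 0.
Proof.
move=> Qq /andP[t0 tT] /derivable_quotient qt Nw.
have t0T : 0 <= t <= T by rewrite !ltW.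
set C := enorm w * enorm (q t) / (4 * r ^+ 2).
set D := fun h => h^-1 *: _ in qt.
have hypo h : h != 0 -> 0 <= t + h <= T ->
    h * dot w (D h) <= h * (C * (h * dot (D h) (D h))).
  move=> h0 /Qq Qh; have := normal_cone_hypomonotone r0 (Qq t t0T) Qh Nw.
  have -> : q (t + h) - q t = h *: D h by rewrite /D scalerA divff// scale1r.
  rewrite !(dotZl, dotZr) -/C => /le_trans; apply.
  by rewrite le_eqVlt; apply/orP; left; apply/eqP; ring.
have cl : (fun h => dot w (D h)) @ 0^' --> dot w ('D_1 q t).
  by apply: cvg_dot => //; exact: cvg_cst.
have cr : (fun h => C * (h * dot (D h) (D h))) @ 0^' --> (0 : R).
  rewrite [X in _ --> X](_ : 0 = C * (0 * dot ('D_1 q t) ('D_1 q t))).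
    apply: cvgM; first exact: cvg_cst.
    apply: cvgM; last exact: cvg_dot.
    exact: cvg_dnbhs0.
  by rewrite mul0r mulr0.
have tht : \forall h \near (0 : R), 0 <= t + h <= T.
  exists (Num.min t (T - t)); first by rewrite /= lt_min t0 subr_gt0.
  move=> h /=; rewrite sub0r normrN lt_min ltr_norml => /andP[/andP[? _]].
  by rewrite ltr_norml => /andP[_ ?]; apply/andP; split; lra.
apply/le_anti/andP; split.
  apply: (ler_cvg_to (cvg_dnbhs_at_right cl) (cvg_dnbhs_at_right cr)).
  near=> h; have h0 : 0 < h by near: h; exact: nbhs_right_gt.
  rewrite -(ler_pM2l h0) hypo ?gt_eqF//.
  by near: h; apply: cvg_within.
apply: (ler_cvg_to (cvg_dnbhs_at_left cr) (cvg_dnbhs_at_left cl)).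
near=> h; have h0 : h < 0 by near: h; exact: nbhs_left_lt.
rewrite -(ler_nM2l h0) hypo ?lt_eqF//.
by near: h; apply: cvg_within.
Unshelve. all: by end_near. Qed.

(** For w = u - q', orthogonality to q' gives |w|^2 = w.u. This bounds the normal component by the
    drift, hence makes the hypomonotonicity constant uniform in time. *)
Lemma normal_cone_residual_le (q : R -> 'M[R]_(N, 2)) (t : R) u :
  (forall s, 0 <= s <= T -> feasible r (q s)) -> 0 < t < T ->
  derivable q t 1 -> normal_cone r (q t) (u - 'D_1 q t) ->
  enorm (u - 'D_1 q t) <= enorm u.
Proof.
move=> Qq tT qt Nw; have := normal_cone_velocity_orth Qq tT qt Nw.
set w := u - _ => wq.
have ww : enorm w ^+ 2 <= enorm w * enorm u.
  rewrite sqr_enorm {2}/w dotDr dotNr wq subr0; exact: dot_le.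
have := enorm_ge0 w; rewrite le_eqVlt => /predU1P[<-|w0]; first exact: enorm_ge0.
by move: ww; rewrite expr2 ler_pM2l.
Qed.

Let gronwall_rate_le (x y z a c g : R) :
  x <= a * g -> - y <= c * g -> z <= c * g ->
  2 * (x - y + z) <= 2 * (a + 2 * c) * g.
Proof. lra. Qed.

Lemma ac_solution_unique (q0 : 'M[R]_(N, 2)) (q1 q2 : R -> 'M[R]_(N, 2)) :
  elipschitz U -> ebounded U ->
  ac_solution r U T q0 q1 -> ac_solution r U T q0 q2 ->
  forall t, 0 <= t <= T -> q1 t = q2 t.
Proof.
move=> [k Uk] [M UM] [ac1 Q1 q10 ae1] [ac2 Q2 q20 ae2].
have [rho1 b1] := abs_continuous_bounded ac1.
have [rho2 b2] := abs_continuous_bounded ac2.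
pose rho := `|rho1| + `|rho2|.
have {}b1 t : 0 <= t <= T -> enorm (q1 t) <= rho.
  move=> /b1/le_trans; apply; rewrite /rho.
  by have := ler_norm rho1; have := normr_ge0 rho2; lra.
have {}b2 t : 0 <= t <= T -> enorm (q2 t) <= rho.
  move=> /b2/le_trans; apply; rewrite /rho.
  by have := ler_norm rho2; have := normr_ge0 rho1; lra.
have rho0 : 0 <= rho by rewrite addr_ge0.
have M0 : 0 <= M by exact: le_trans (enorm_ge0 _) (UM 0).
pose C := M * rho / (4 * r ^+ 2).
have r20 : 0 < 4 * r ^+ 2 by rewrite mulr_gt0// exprn_gt0.
have C0 : 0 <= C by rewrite divr_ge0 ?mulr_ge0// ltW.
pose D t := q1 t - q2 t.
pose f t := dot (D t) (D t).
suff f_le0 t : 0 <= t <= T -> f t <= 0.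
  move=> t /f_le0 ft; apply/eqP; rewrite -subr_eq0; apply/eqP/dot_eq0/le_anti.
  by rewrite ft dot_ge0.
move: t; apply: (@ac_gronwall _ f (2 * (`|k| + 2 * C))).
- by rewrite mulr_ge0// addr_ge0// mulr_ge0.
(* |f y - f x| <= |D y - D x| |D y + D x|, and the last factor is at most 4 rho; the added 1 only
   keeps the divisor positive. *)
- move=> e e0; have L0 : 0 < 4 * rho + 1 by rewrite ltr_wpDl// mulr_ge0.
  pose e' := e / (4 * rho + 1) / 2.
  have e'0 : 0 < e' by rewrite !divr_gt0.
  have [d1 d10 h1] := ac1 _ e'0; have [d2 d20 h2] := ac2 _ e'0.
  exists (Num.min d1 d2); first by rewrite lt_min d10.
  move=> p x y xy txy; rewrite lt_min => /andP[/(h1 p x y xy txy) s1 /(h2 p x y xy txy) s2].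
  apply: (@le_lt_trans _ _ ((4 * rho + 1) *
    (\sum_(k < p) enorm (q1 (y k) - q1 (x k)) + \sum_(k < p) enorm (q2 (y k) - q2 (x k))))).
    rewrite -big_split mulr_sumr; apply: ler_sum => i _.
    have [x0 xiy yT] := xy i.
    have xT : 0 <= x i <= T by rewrite x0 (le_trans xiy).
    have yT' : 0 <= y i <= T by rewrite yT (le_trans x0).
    rewrite /f dot_subr_sqr.
    apply: le_trans (cauchy_schwarz _ _) _; rewrite mulrC ler_pM ?enorm_ge0//.
      have := enormD (D (y i)) (D (x i)); have := enormD (q1 (y i)) (- q2 (y i)).
      have := enormD (q1 (x i)) (- q2 (x i)); rewrite !enormN -/(D _).
      by move: (b1 _ xT) (b2 _ xT) (b1 _ yT') (b2 _ yT'); lra.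
    have -> : D (y i) - D (x i) = (q1 (y i) - q1 (x i)) - (q2 (y i) - q2 (x i)).
      by apply/matrixP => a b; rewrite !mxE; ring.
    by apply: le_trans (enormD _ _) _; rewrite enormN.
  by rewrite mulrC -ltr_pdivlMr//; move: s1 s2; rewrite /e'; lra.
- by rewrite /f /D q10 q20 subrr -(scale0r 0) dotZl mul0r.
- have aeF := ae_filter_ringOfSetsType (@lebesgue_measure R).
  move: ae1 ae2; apply: filterS2 => t ae1t ae2t /[dup] tT /andP[/ltW t0 /ltW tT'] e e0.
  have t0T : 0 <= t <= T by rewrite t0.
  have [d1 N1] := ae1t t0T; have [d2 N2] := ae2t t0T.
  have w1 := normal_cone_residual_le Q1 tT d1 N1.
  have w2 := normal_cone_residual_le Q2 tT d2 N2.
  have p1 := normal_cone_hypomonotone r0 (Q1 _ t0T) (Q2 _ t0T) N1.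
  have p2 := normal_cone_hypomonotone r0 (Q2 _ t0T) (Q1 _ t0T) N2.
  move: (derivable_quotient d1) (derivable_quotient d2).
  move: p1 p2 w1 w2; set v1 := 'D_1 q1 t; set v2 := 'D_1 q2 t => p1 p2 w1 w2 c1 c2.
  have hypo (q w u : 'M[R]_(N, 2)) : enorm w <= enorm (U u) -> enorm q <= rho ->
      enorm w * enorm q / (4 * r ^+ 2) * f t <= C * f t.
    move=> wU qrho; rewrite ler_wpM2r ?dot_ge0// ler_wpM2r ?invr_ge0 ?(ltW r20)//.
    by rewrite ler_pM ?enorm_ge0// (le_trans wU).
  (* v1 - v2 is the difference of the drifts minus that of the normal vectors. Each normal vector,
     tested against the other solution, contributes at most C f t. *)
  have dv : 2 * dot (D t) (v1 - v2) <= 2 * (`|k| + 2 * C) * f t.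
    have -> : v1 - v2 = (U (q1 t) - U (q2 t)) - (U (q1 t) - v1) + (U (q2 t) - v2).
      by apply/matrixP => i j; rewrite !mxE; ring.
    move: p1 p2; have -> : q2 t - q1 t = - D t by rewrite opprB.
    rewrite -/(D t) -/(f t) [dot (- D t) (- D t)]dotNl [dot (D t) (- D t)]dotNr opprK.
    rewrite -/(f t) dotNr => p1 p2.
    have {}p1 := le_trans p1 (hypo _ _ _ w1 (b1 _ t0T)).
    have {}p2 := le_trans p2 (hypo _ _ _ w2 (b2 _ t0T)).
    have dotd (a b c d : 'M[R]_(N, 2)) : dot d (a - b + c) = dot d a - dot b d + dot c d.
      by rewrite !dotE (dotC b) (dotC c).
    rewrite dotd.
    apply: (@gronwall_rate_le _ _ _ `|k| C (f t) _ p1 p2).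
    have : dot (D t) (U (q1 t) - U (q2 t)) <= `|k| * f t.
      apply: le_trans (dot_le _ _) _; rewrite /f -sqr_enorm expr2 mulrCA.
      rewrite ler_wpM2l ?enorm_ge0// (le_trans (Uk _ _))// ler_wpM2r ?enorm_ge0//.
      exact: ler_norm.
    exact.
  pose Q h := h^-1 *: (q1 (t + h) - q1 t) - h^-1 *: (q2 (t + h) - q2 t).
  have cQ : Q @ 0^' --> v1 - v2 by exact: (cvgB c1 c2).
  have cg : (fun h => 2 * dot (D t) (Q h) + h * dot (Q h) (Q h)) @ 0^'+ -->
      2 * dot (D t) (v1 - v2).
    rewrite -[X in _ --> X]addr0 -[X in _ --> _ + X](mul0r (dot (v1 - v2) (v1 - v2))).
    apply: cvg_dnbhs_at_right; apply: cvgD.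
      by apply: cvgM; [exact: cvg_cst|apply: cvg_dot => //; exact: cvg_cst].
    by apply: cvgM; [exact: cvg_dnbhs0|exact: cvg_dot].
  have lt_e : 2 * dot (D t) (v1 - v2) < 2 * (`|k| + 2 * C) * f t + e.
    by apply: le_lt_trans dv _; rewrite ltrDl.
  have ng := cvgr_le _ cg _ lt_e.
  near=> h; have h0 : 0 < h by near: h; exact: nbhs_right_gt.
  (* An exact expansion in the difference quotient [Q h]; the bracket tends to 2 D.(v1 - v2) as h
     tends to 0. *)
  have -> : f (t + h) - f t = h * (2 * dot (D t) (Q h) + h * dot (Q h) (Q h)).
    have -> : f (t + h) = dot (D t + h *: Q h) (D t + h *: Q h).
      suff -> : D t + h *: Q h = D (t + h) by [].
      rewrite /Q -scalerBr scalerA divff ?gt_eqF// scale1r.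
      by apply/matrixP => i j; rewrite !mxE; ring.
    by rewrite dot_sqrD !(dotZl, dotZr) /f; ring.
  by rewrite ler_pM2l//; near: h; exact: ng.
Unshelve. all: by end_near. Qed.
End uniqueness.

(** * The catching-up scheme *)

(** Each entry stays in a compact segment, and a cluster point of an ultrafilter is a limit. One
    ultrafilter thus serves all times at once, without extraction of subsequences. *)
Lemma ultra_bounded_cvg {R : realType} {m n : nat} {I : Type} (F : set_system I)
    (f : I -> 'M[R]_(m, n)) (B : R) : UltraFilter F ->
  (forall k, enorm (f k) <= B) -> exists l : 'M[R]_(m, n), f @ F --> l.
Proof.
move=> FU fB.
suff /choice[g gl] : forall ij : 'I_m * 'I_n, exists l : R,
    (fun k => f k ij.1 ij.2) @ F --> l.
  exists (\matrix_(i, j) g (i, j)); apply: cvg_coord => i j; rewrite mxE.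
  exact: (gl (i, j)).
move=> [i j] /=; set u := fun k => f k i j.
have uB k : `[- B, B]%classic (u k).
  rewrite /= in_itv/= -ler_norml; exact: le_trans (enorm_coord _ _ _) (fB k).
have [|l [_ ul]] := @segment_compact _ (- B) B (u @ F) _.
  exact: (@filterE _ F _ (u @^-1` _) uB).
exists l => V Vl; have [//|nV] := in_ultra_setVsetC (u @^-1` V) FU.
have [x [nVx Vx]] := ul (~` V) V nV Vl.
by [].
Qed.

(** A minimizing sequence is bounded, and its limit along an ultrafilter attains the infimum.
    Convexity is not assumed, so the point need not be unique. *)
Lemma exists_nearest_point {R : realType} {m n : nat} (A : set 'M[R]_(m, n)) x :
  closed A -> A !=set0 ->
  exists2 p, A p & forall z, A z -> enorm (x - p) <= enorm (x - z).
Proof.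
move=> clA [z0 Az0].
pose D := [set enorm (x - z) | z in A].
have infD : has_inf D.
  by split; [exists (enorm (x - z0)), z0|exists 0 => _ [z _ <-]; exact: enorm_ge0].
have /choice[p pP] : forall k : nat, exists p, A p /\ enorm (x - p) < inf D + k.+1%:R^-1.
  move=> k; have k0 : 0 < k.+1%:R^-1 :> R by rewrite invr_gt0 ltr0n.
  have [_ [p Ap <-] pk] := inf_adherent k0 infD.
  by exists p.
have [F [FU ooF]] := ultraFilterLemma (@eventually_filter).
have pB k : enorm (p k) <= enorm x + (inf D + 1).
  have [_ /ltW pk] := pP k.
  have -> : p k = x - (x - p k) by rewrite subKr.
  rewrite (le_trans (enormD _ _))// lerD2l enormN (le_trans pk)// lerD2l.
  by rewrite invf_le1 ?ltr0n// ler1n.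
have [l pl] := ultra_bounded_cvg FU pB.
exists l.
  by apply: (@closed_cvg _ _ F _ p A clA _ l pl); apply: filterE => k; have [] := pP k.
move=> z Az; apply: (@le_trans _ _ (inf D)); last by apply: ge_inf; [have [] := infD|exists z].
rewrite -[leRHS]addr0.
have c1 : (fun k => enorm (x - p k)) @ F --> enorm (x - l).
  by apply: cvg_enorm; apply: cvgB => //; exact: cvg_cst.
have c2 : (fun k : nat => inf D + k.+1%:R^-1) @ F --> inf D + 0.
  apply: cvgD; first exact: cvg_cst.
  apply: cvg_trans (@cvg_harmonic R) => V /ooF; exact.
apply: (ler_cvg_to c1 c2); apply: filterE => k.
by have [_ /ltW] := pP k.
Qed.

Lemma feasible_closed {R : realType} {N : nat} (r : R) : closed (@feasible R N r).
Proof.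
have -> : @feasible R N r = \bigcap_(ij in [set ij : 'I_N * 'I_N | (ij.1 < ij.2)%N])
    (dist r ij.1 ij.2 @^-1` [set x | 0 <= x]).
  apply/seteqP; split => q Qq; first by move=> [i j] /=; exact: Qq.
  by move=> i j ij; exact: (Qq (i, j)).
apply: closed_bigI => -[i j] _ /=.
apply: closed_comp; last exact: closed_ge.
move=> q _.
have rowc (k : 'I_N) : (fun x : 'M[R]_(N, 2) => row k x) @ q --> row k q.
  apply: (@cvg_coord _ _ _ _ (nbhs q) (nbhs_filter q)) => a b; rewrite mxE.
  rewrite (_ : (fun x => _) = (fun x : 'M[R]_(N, 2) => x k b)); first exact: coord_continuous.
  by apply/funext => x; rewrite mxE.
have c1 : (fun x : 'M[R]_(N, 2) => enorm (row i x - row j x)) @ q -->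
    enorm (row i q - row j q).
  exact: (cvg_enorm (cvgB (rowc i) (rowc j))).
exact: (cvgB c1 (cvg_cst (2 * r))).
Qed.

Section scheme.
Context {R : realType} {N : nat} (r : R).
Hypothesis r0 : 0 < r.
Variables (U : 'M[R]_(N, 2) -> 'M[R]_(N, 2)) (M : R).
Hypothesis UM : forall x, enorm (U x) <= M.
Implicit Types p q z : 'M[R]_(N, 2).

Let half_le (a b c : R) : a <= a - 2 * b + c -> b <= 1 / 2 * c.
Proof. lra. Qed.

(** Only consequences of p' being a feasible point nearest to p + h U p are recorded. In the bound 2
    M h, one M h comes from the drift and the other from the projection. *)
Definition catching_up_step (h : R) p p' : Prop :=
  [/\ feasible r p', enorm (p' - p) <= 2 * M * h &
    forall z, feasible r z -> dot (p' - p) (p' - z) <=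
      h * (dot (U p) (p' - z) +
           M * enorm p' / (4 * r ^+ 2) * dot (p' - z) (p' - z))].

(** Minimality of |x - p'| makes w = x - p' a proximal normal with constant 1 / 2, hence an element
    of the normal cone. Hypomonotonicity then trades 1 / 2 for a constant proportional to |w| <= h
    M; this factor h is what allows summation over the steps. *)
Lemma exists_catching_up_step (h : R) p : 0 <= h -> feasible r p ->
  exists p', catching_up_step h p p'.
Proof.
move=> h0 Qp; pose x := p + h *: U p.
have [p' Qp' xp'] := exists_nearest_point x (@feasible_closed _ _ r) (ex_intro _ p Qp).
pose w := x - p'.
have whM : enorm w <= h * M.
  rewrite (le_trans (xp' _ Qp))// /x addrC addKr enormZ ger0_norm// ler_wpM2l//.
have Nw : normal_cone r p' w.
  apply: (@prox_normal_cone _ _ _ r0 (1 / 2)) => // z Qz.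
  have := xp' z Qz; rewrite -ler_sqr ?nnegrE ?enorm_ge0// !sqr_enorm -/w.
  have -> : x - z = w + - (z - p') by rewrite /w opprB addrA subrK.
  rewrite (dot_sqrD w) !dotNr !dotNl opprK => h1.
  by apply: (@half_le (dot w w)); rewrite -mulrN.
have pE : p' - p = h *: U p - w.
  by rewrite /w /x; apply/matrixP => i j; rewrite !mxE; ring.
exists p'; split => //.
  rewrite pE.
  rewrite (le_trans (enormD _ _))// enormN enormZ ger0_norm//.
  have -> : 2 * M * h = h * M + h * M by ring.
  by rewrite lerD// ler_wpM2l.
move=> z Qz; rewrite pE (dotDl (h *: U p)) (dotZl h) (dotNl w) -(dotNr w) opprB mulrDr lerD2l.
apply: le_trans (normal_cone_hypomonotone r0 Qp' Qz Nw) _.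
have -> : dot (z - p') (z - p') = dot (p' - z) (p' - z).
  by rewrite -opprB dotNl dotNr opprK.
rewrite !mulrA ler_wpM2r ?dot_ge0// ler_wpM2r ?invr_ge0 ?mulr_ge0 ?exprn_ge0 ?(ltW r0)//.
by rewrite ler_wpM2r ?enorm_ge0.
Qed.

Lemma exists_catching_up (h : R) q0 : 0 <= h -> feasible r q0 ->
  exists p : nat -> 'M[R]_(N, 2),
    [/\ p 0%N = q0, forall n, feasible r (p n) &
        forall n, catching_up_step h (p n) (p n.+1)].
Proof.
move=> h0 Qq0.
have /choice[s sP] : forall p, exists p', feasible r p -> catching_up_step h p p'.
  move=> p; have [Qp|nQp] := pselect (feasible r p); last by exists p.
  by have [p' ?] := exists_catching_up_step h0 Qp; exists p'.
pose p n := iter n s q0.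
have Qpn n : feasible r (p n) by elim: n => //= n /sP[].
exists p; split => // n.
exact: (sP _ (Qpn n)).
Qed.

Lemma catching_up_lipschitz (h : R) (p : nat -> 'M[R]_(N, 2)) :
  (forall n, catching_up_step h (p n) (p n.+1)) ->
  forall m d, enorm (p (m + d)%N - p m) <= 2 * M * (d%:R * h).
Proof.
move=> ps m; elim=> [|d IHd].
  by rewrite addn0 subrr mul0r mulr0 -(scale0r 0) enormZ normr0 mul0r.
rewrite addnS (le_trans (enormDB _ (p (m + d)%N) _))//.
have [_ + _] := ps (m + d)%N => /lerD/(_ IHd)/le_trans; apply.
rewrite -mulrDr (_ : d.+1%:R * h = h + d%:R * h)//.
by rewrite -[d.+1%:R]natr1; ring.
Qed.

End scheme.

(** * The discrete evolution variational inequality *)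

Lemma half_sqr_diff_le {R : realType} {m n : nat} (x y z : 'M[R]_(m, n)) :
  1 / 2 * dot (y - z) (y - z) - 1 / 2 * dot (x - z) (x - z) <=
  dot (y - x) (y - z).
Proof.
have -> : x - z = (y - z) - (y - x).
  by apply/matrixP => i j; rewrite !mxE; ring.
move: (y - z) (y - x) => {x y z} u v.
rewrite dot_sqrD !dotNr !dotNl opprK (dotC u v).
by have := dot_ge0 v; move: (dot u u) (dot v u) (dot v v) => a b c; lra.
Qed.

(** The upper bound [half_sqr_diff_le] is used on every single step, where the increments of |p -
    z|^2 / 2 telescope; this lower bound then turns the total increment back into an inner product
    at the initial point. *)
Lemma half_sqr_diff_ge {R : realType} {m n : nat} (x y z : 'M[R]_(m, n)) :
  dot (y - x) (x - z) <=
  1 / 2 * dot (y - z) (y - z) - 1 / 2 * dot (x - z) (x - z).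
Proof.
have -> : y - z = (x - z) + (y - x).
  by apply/matrixP => i j; rewrite !mxE; ring.
move: (x - z) (y - x) => {x y z} u v.
rewrite dot_sqrD (dotC u v).
by have := dot_ge0 v; move: (dot u u) (dot v u) (dot v v) => a b c; lra.
Qed.

Section discrete_inequality.
Context {R : realType} {N : nat} (r : R).
Hypothesis r0 : 0 < r.
Variables (U : 'M[R]_(N, 2) -> 'M[R]_(N, 2)) (k M : R).
Hypothesis k0 : 0 <= k.
Hypothesis Uk : forall x y, enorm (U x - U y) <= k * enorm (x - y).
Hypothesis UM : forall x, enorm (U x) <= M.

Let M0 : 0 <= M. Proof. exact: le_trans (enorm_ge0 _) (UM 0). Qed.

(** Two configurations occur because a step evaluates the drift at the old point and everything else
    at the new one. *)
Definition evi_form (C : R) (p q z : 'M[R]_(N, 2)) : R :=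
  dot (U p) (q - z) + C * dot (q - z) (q - z).

Lemma evi_form_le (C L s : R) a b c z : 0 <= C ->
  enorm (a - c) <= s -> enorm (b - c) <= s ->
  enorm (b - z) <= L -> enorm (c - z) <= L ->
  evi_form C a b z <= evi_form C c c z + (k * L + M + 2 * C * L) * s.
Proof.
move=> C0 acs bcs bzL czL.
have s0 : 0 <= s by exact: le_trans (enorm_ge0 _) acs.
have L0 : 0 <= L by exact: le_trans (enorm_ge0 _) bzL.
have -> : evi_form C a b z = evi_form C c c z +
    (dot (U a - U c) (b - z) + dot (U c) (b - c) +
     C * dot (b - c) ((b - z) + (c - z))).
  have <- : (b - z) - (c - z) = b - c by apply/matrixP => i j; rewrite !mxE; ring.
  rewrite -dot_subr_sqr /evi_form.
  move: (U a) (U c) (b - z) (c - z) => u v x y.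
  by rewrite dotDl dotDr !dotNl dotNr; ring.
have -> : (k * L + M + 2 * C * L) * s = k * s * L + M * s + C * (s * (L + L)) by ring.
rewrite lerD2l lerD//; first rewrite lerD//.
- apply: le_trans (dot_le _ _) _; rewrite ler_pM ?enorm_ge0//.
  by rewrite (le_trans (Uk _ _))// ler_wpM2l.
- by apply: le_trans (dot_le _ _) _; rewrite ler_pM ?enorm_ge0.
- rewrite ler_wpM2l//; apply: le_trans (dot_le _ _) _; rewrite ler_pM ?enorm_ge0//.
  by rewrite (le_trans (enormD _ _))// lerD.
Qed.

(** The right-hand side of every step is frozen at [p m], at the cost of an error controlled by the
    displacement 2 M d h, and the steps are summed. The constants depend on z, T and the initial
    point but not on h, so the inequality is uniform in the step size. *)
Lemma catching_up_evi (T h rho C L : R) (p : nat -> 'M[R]_(N, 2)) z (m d : nat) :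
  0 <= h -> feasible r z -> (forall n, catching_up_step r U M h (p n) (p n.+1)) ->
  (m + d)%:R * h <= T ->
  rho = enorm (p 0%N) + 2 * M * T -> C = M * rho / (4 * r ^+ 2) ->
  L = rho + enorm z ->
  dot (p (m + d)%N - p m) (p m - z) <= d%:R * h *
    (evi_form C (p m) (p m) z + 2 * M * (k * L + M + 2 * C * L) * (d%:R * h)).
Proof.
move=> h0 Qz ps mdT rhoE CE LE.
have T0 : 0 <= T by apply: le_trans mdT; rewrite mulr_ge0.
have rho0 : 0 <= rho by rewrite rhoE addr_ge0 ?enorm_ge0 ?mulr_ge0.
have r20 : 0 < 4 * r ^+ 2 by rewrite mulr_gt0// exprn_gt0.
have C0 : 0 <= C by rewrite CE divr_ge0 ?mulr_ge0// ltW.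
have prho j : (j <= m + d)%N -> enorm (p j) <= rho.
  move=> jmd; rewrite rhoE -[p j](subrK (p 0%N)) (le_trans (enormD _ _))// addrC lerD2l.
  rewrite (le_trans (catching_up_lipschitz ps 0 j))// ler_wpM2l ?mulr_ge0//.
  by rewrite (le_trans _ mdT)// ler_wpM2r// ler_nat.
have pzL j : (j <= m + d)%N -> enorm (p j - z) <= L.
  by move=> jmd; rewrite LE (le_trans (enormD _ _))// enormN lerD2r prho.
set s := d%:R * h; set A := k * L + M + 2 * C * L.
have step e : (e < d)%N ->
  1 / 2 * dot (p (m + e).+1 - z) (p (m + e).+1 - z) -
  1 / 2 * dot (p (m + e)%N - z) (p (m + e)%N - z) <=
  h * (evi_form C (p m) (p m) z + 2 * M * A * s).
  move=> ed; apply: le_trans (half_sqr_diff_le _ _ _) _.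
  have [_ _ /(_ z Qz)/le_trans] := ps (m + e)%N; apply.
  have med : ((m + e).+1 <= m + d)%N by rewrite -addnS leq_add2l.
  apply: ler_wpM2l => //.
  apply: (@le_trans _ _ (evi_form C (p (m + e)%N) (p (m + e).+1) z)).
    rewrite /evi_form lerD2l ler_wpM2r ?dot_ge0// CE ler_wpM2r ?invr_ge0 ?(ltW r20)//.
    by rewrite ler_wpM2l// prho.
  have -> : 2 * M * A * s = A * (2 * M * s) by ring.
  apply: evi_form_le => //.
  - rewrite (le_trans (catching_up_lipschitz ps m e))// ler_wpM2l ?mulr_ge0//.
    by rewrite ler_wpM2r// ler_nat ltnW.
  - rewrite -addnS (le_trans (catching_up_lipschitz ps m e.+1))// ler_wpM2l ?mulr_ge0//.
    by rewrite ler_wpM2r// ler_nat.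
  - exact: pzL.
  - by apply: pzL; rewrite leq_addr.
apply: le_trans (half_sqr_diff_ge _ _ _) _.
have sum e : (e <= d)%N ->
  1 / 2 * dot (p (m + e)%N - z) (p (m + e)%N - z) - 1 / 2 * dot (p m - z) (p m - z) <=
  e%:R * h * (evi_form C (p m) (p m) z + 2 * M * A * s).
  elim: e => [_|e IHe ed]; first by rewrite addn0 subrr !mul0r.
  have := IHe (ltnW ed); have := step e ed; rewrite addnS.
  rewrite -[e.+1%:R]natr1.
  move: (dot _ _) (dot _ _) (dot _ _) (evi_form C (p m) (p m) z + _) => a b c B; lra.
exact: sum.
Qed.

End discrete_inequality.

(** * Existence *)

Lemma elipschitz_cvg {R : realType} {m n : nat} (U : 'M[R]_(m, n) -> 'M[R]_(m, n))
    (k : R) {S : Type} (F : set_system S) {FF : ProperFilter F}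
    (f : S -> 'M[R]_(m, n)) l :
  (forall x y, enorm (U x - U y) <= k * enorm (x - y)) ->
  f @ F --> l -> (fun s => U (f s)) @ F --> U l.
Proof.
move=> Uk fl; apply: enorm_cvg0.
have c0 : (fun s => k * enorm (f s - l)) @ F --> 0.
  rewrite -(mulr0 k) -[in X in _ --> X](_ : enorm (l - l) = 0).
    apply: cvgM; first exact: cvg_cst.
    by apply: cvg_enorm; apply: cvgB => //; exact: cvg_cst.
  by rewrite subrr -(scale0r 0) enormZ normr0 mul0r.
apply: (squeeze_cvgr _ (cvg_cst 0) c0).
by apply: filterE => s; rewrite enorm_ge0 Uk.
Qed.

Lemma lipschitz_abs_continuous {R : realType} {m n : nat} (a b L : R)
    (f : R -> 'M[R]_(m, n)) :
  (forall x y, x <= y -> enorm (f y - f x) <= L * (y - x)) -> abs_continuous a b f.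
Proof.
move=> fL e e0; have L1 : 0 < `|L| + 1 by rewrite ltr_wpDl.
exists (e / (`|L| + 1)); first by rewrite divr_gt0.
move=> p x y xy _; rewrite ltr_pdivlMr// mulrC; apply: le_lt_trans.
rewrite mulr_sumr; apply: ler_sum => i _; have [_ xiy _] := xy i.
rewrite (le_trans (fL _ _ xiy))// ler_wpM2r ?subr_ge0//.
by rewrite (le_trans (ler_norm _))// lerDl.
Qed.

Section existence.
Context {R : realType} {N : nat} (r : R).
Hypothesis r0 : 0 < r.
Variables (U : 'M[R]_(N, 2) -> 'M[R]_(N, 2)) (k M : R).
Hypothesis k0 : 0 <= k.
Hypothesis Uk : forall x y, enorm (U x - U y) <= k * enorm (x - y).
Hypothesis UM : forall x, enorm (U x) <= M.
Variables (T : R) (q0 : 'M[R]_(N, 2)).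
Hypothesis T0 : 0 < T.
Hypothesis Qq0 : feasible r q0.

Let M0 : 0 <= M. Proof. exact: le_trans (enorm_ge0 _) (UM 0). Qed.

(** Piecewise constant interpolations of the scheme converge pointwise along an ultrafilter, and the
    two-time inequalities pass to the limit. The order of quantifiers matters: [C] is independent of
    z, as [prox_normal_cone] requires, whereas [A] multiplies a term that vanishes after
    differentiation. *)
Lemma exists_evi_solution : exists q : R -> 'M[R]_(N, 2),
  [/\ q 0 = q0, forall t, feasible r (q t),
    forall s t, s <= t -> enorm (q t - q s) <= 2 * M * (clamp T t - clamp T s) &
    exists C, forall z, feasible r z -> exists A, forall s t, s <= t ->
      dot (q t - q s) (q s - z) <= (clamp T t - clamp T s) *
        (evi_form U C (q s) (q s) z + A * (clamp T t - clamp T s)) ].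
Proof.
pose h n : R := n.+1%:R^-1.
have h0 n : 0 <= h n by rewrite invr_ge0.
have /choice[P PP] := fun n => exists_catching_up r0 UM (h0 n) Qq0.
have P0 n : P n 0%N = q0 by have [] := PP n.
have PQ n j : feasible r (P n j) by have [_ + _] := PP n; exact.
have PS n j : catching_up_step r U M (h n) (P n j) (P n j.+1).
  by have [_ _] := PP n; exact.
pose c := clamp T; have cT t : 0 <= c t <= T by apply: clamp_itv; exact: ltW.
(* The number of complete steps of length [h n] up to the clamped time; [d n t] is the corresponding
   grid time, less than one step behind. *)
pose idx n t := Num.truncn (c t * n.+1%:R).
pose d n t : R := (idx n t)%:R * h n.
have n1 n : 0 < n.+1%:R :> R by rewrite ltr0n.
have dle n t : d n t <= c t.
  rewrite /d ler_pdivrMr//; have /andP[ct0 _] := cT t.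
  by have /andP[] := truncn_itv (mulr_ge0 ct0 (ltW (n1 n))).
have dgt n t : c t < d n t + h n.
  have -> : d n t + h n = (idx n t).+1%:R * h n.
    by rewrite -[in RHS]natr1 mulrDl mul1r.
  rewrite ltr_pdivlMr//; have /andP[ct0 _] := cT t.
  by have /andP[] := truncn_itv (mulr_ge0 ct0 (ltW (n1 n))).
have idx_le n s t : s <= t -> (idx n s <= idx n t)%N.
  move=> st; apply: le_truncn; rewrite ler_wpM2r//.
  by have /andP[] := clamp_diff (ltW T0) st; rewrite subr_ge0.
have [F [FU ooF]] := ultraFilterLemma (@eventually_filter).
have hF : h @ F --> (0 : R).
  by apply: cvg_trans (@cvg_harmonic R) => V /ooF; exact.
have dF t : (fun n => d n t) @ F --> c t.
  have cl : (fun n => c t - h n) @ F --> c t.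
    by rewrite -[X in _ --> X]subr0; apply: cvgB => //; exact: cvg_cst.
  apply: (squeeze_cvgr _ cl (cvg_cst (c t))).
  by apply: filterE => n; rewrite dle andbT lerBlDr ltW.
pose rho := enorm q0 + 2 * M * T.
have Plip n s t : s <= t ->
    enorm (P n (idx n t) - P n (idx n s)) <= 2 * M * (d n t - d n s).
  move=> st; have := catching_up_lipschitz (PS n) (idx n s) (idx n t - idx n s).
  by rewrite subnKC ?idx_le// natrB ?idx_le// mulrBl.
have Prho t n : enorm (P n (idx n t)) <= rho.
  have := catching_up_lipschitz (PS n) 0 (idx n t); rewrite add0n P0 -/(d n t) => h1.
  rewrite -[P n _](subrK q0) (le_trans (enormD _ _))// addrC lerD2l.
  rewrite (le_trans h1)// ler_wpM2l ?mulr_ge0// (le_trans (dle _ _))//.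
  by have /andP[] := cT t.
have /choice[q qP] : forall t, exists l : 'M[R]_(N, 2), (fun n => P n (idx n t)) @ F --> l.
  by move=> t; exact: (ultra_bounded_cvg FU (Prho t)).
exists q; split.
- have c1 : (fun n => P n (idx n 0)) @ F --> q0.
    rewrite (_ : (fun n => _) = cst q0); first exact: cvg_cst.
    apply/funext => n; rewrite /idx /c clamp_le0 ?mul0r ?(ltW T0)// truncn0.
    exact: P0.
  exact: (cvg_unique _ (qP 0) c1).
- move=> t; apply: (@closed_cvg _ _ F _ (fun n => P n (idx n t)) _ (@feasible_closed _ _ r) _ (q t) (qP t)).
  by apply: filterE => n; exact: PQ.
- move=> s t st.
  have c1 : (fun n => enorm (P n (idx n t) - P n (idx n s))) @ F --> enorm (q t - q s).
    exact: (cvg_enorm (cvgB (qP t) (qP s))).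
  have c2 : (fun n => 2 * M * (d n t - d n s)) @ F --> 2 * M * (c t - c s).
    by apply: cvgM; [exact: cvg_cst|exact: cvgB].
  rewrite -/c; apply: (ler_cvg_to c1 c2).
  by apply: filterE => n; exact: Plip.
- pose C := M * rho / (4 * r ^+ 2); exists C => z Qz.
  pose L := rho + enorm z; pose A := 2 * M * (k * L + M + 2 * C * L); exists A => s t st.
  have qz : (fun n => P n (idx n s) - z) @ F --> q s - z.
    by apply: cvgB => //; exact: cvg_cst.
  have c1 : (fun n => dot (P n (idx n t) - P n (idx n s)) (P n (idx n s) - z)) @ F -->
      dot (q t - q s) (q s - z) by exact: (cvg_dot (cvgB (qP t) (qP s)) qz).
  have dd : (fun n => d n t - d n s) @ F --> c t - c s by exact: (cvgB (dF t) (dF s)).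
  have c2 : (fun n => evi_form U C (P n (idx n s)) (P n (idx n s)) z) @ F -->
      evi_form U C (q s) (q s) z.
    apply: cvgD; first exact: (cvg_dot (elipschitz_cvg Uk (qP s)) qz).
    by apply: cvgM; [exact: cvg_cst|exact: cvg_dot].
  have c3 : (fun n => (d n t - d n s) * (evi_form U C (P n (idx n s)) (P n (idx n s)) z +
      A * (d n t - d n s))) @ F --> (c t - c s) *
        (evi_form U C (q s) (q s) z + A * (c t - c s)).
    apply: cvgM; first exact: dd.
    by apply: cvgD => //; apply: cvgM; [exact: cvg_cst|exact: dd].
  apply: (ler_cvg_to c1 c3); apply: filterE => n.
  have mdT : (idx n s + (idx n t - idx n s))%:R * h n <= T.
    by rewrite subnKC ?idx_le// (le_trans (dle n t))//; have /andP[] := cT t.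
  have rhoE : rho = enorm (P n 0%N) + 2 * M * T by rewrite P0.
  have := catching_up_evi r0 k0 Uk UM (h0 n) Qz (PS n) mdT rhoE erefl erefl.
  by rewrite subnKC ?idx_le// natrB ?idx_le// mulrBl.
Qed.

End existence.

(** * From the variational inequality to the differential inclusion *)

Section evi_solution.
Context {R : realType} {N : nat} (r : R).
Hypothesis r0 : 0 < r.
Variables (U : 'M[R]_(N, 2) -> 'M[R]_(N, 2)).

(** Divide the inequality between t and t + h by h and let h decrease to 0. What remains is (q' -
    U).(q - z) <= C |q - z|^2, the proximal inequality for U - q'. *)
Lemma evi_normal_cone (T C : R) (q : R -> 'M[R]_(N, 2)) (t : R) :
  0 < t < T -> feasible r (q t) -> derivable q t 1 ->
  (forall z, feasible r z -> exists A, forall s t, s <= t ->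
      dot (q t - q s) (q s - z) <= (clamp T t - clamp T s) *
        (evi_form U C (q s) (q s) z + A * (clamp T t - clamp T s))) ->
  normal_cone r (q t) (U (q t) - 'D_1 q t).
Proof.
move=> /andP[t0 tT] Qt /derivable_quotient qt evi.
apply: (@prox_normal_cone _ _ _ r0 C) => // z /evi[A eviA].
suff : dot ('D_1 q t) (q t - z) <= evi_form U C (q t) (q t) z.
  rewrite -(opprB (q t) z) /evi_form.
  move: (q t - z) ('D_1 q t) (U (q t)) => x v u; rewrite !dotNr !dotNl dotDl dotNl.
  by move: (dot v x) (dot u x) (dot x x) => a b c; lra.
have cl : (fun h => dot (h^-1 *: (q (t + h) - q t)) (q t - z)) @ 0^' -->
    dot ('D_1 q t) (q t - z).
  by apply: cvg_dot => //; exact: cvg_cst.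
have cr : (fun h => evi_form U C (q t) (q t) z + A * h) @ 0^' -->
    evi_form U C (q t) (q t) z.
  rewrite -[X in _ --> X]addr0 -[X in _ --> _ + X](mulr0 A).
  by apply: cvgD; [exact: cvg_cst|apply: cvgM; [exact: cvg_cst|exact: cvg_dnbhs0]].
apply: (ler_cvg_to (cvg_dnbhs_at_right cl) (cvg_dnbhs_at_right cr)).
near=> h; have h0 : 0 < h by near: h; exact: nbhs_right_gt.
have hT : h <= T - t by near: h; apply: nbhs_right_le; rewrite subr_gt0.
have tth : t <= t + h by rewrite lerDl ltW.
have := eviA t (t + h) tth.
have t0T : 0 <= t <= T by rewrite !ltW.
have th0T : 0 <= t + h <= T.
  apply/andP; split; last by rewrite -lerBrDl.
  by rewrite (le_trans _ tth)// ltW.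
rewrite (clamp_id t0T) (clamp_id th0T) addrAC subrr add0r => eh.
by rewrite dotZl -(ler_pM2l h0) mulrA divff ?gt_eqF// mul1r.
Unshelve. all: by end_near. Qed.

Lemma exists_ac_solution (T : R) (q0 : 'M[R]_(N, 2)) :
  elipschitz U -> ebounded U -> 0 < T -> feasible r q0 ->
  exists q, ac_solution r U T q0 q.
Proof.
move=> [k Uk'] [M UM] T0 Qq0.
have Uk x y : enorm (U x - U y) <= `|k| * enorm (x - y).
  by rewrite (le_trans (Uk' _ _))// ler_wpM2r ?enorm_ge0// ler_norm.
have M0 : 0 <= M by exact: le_trans (enorm_ge0 _) (UM 0).
have [q [q00 Qq qlip [C evi]]] := exists_evi_solution r0 (normr_ge0 k) Uk UM T0 Qq0.
have T0W := ltW T0.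
have lipq x y : x <= y -> enorm (q y - q x) <= 2 * M * (y - x).
  move=> xy; rewrite (le_trans (qlip _ _ xy))// ler_wpM2l ?mulr_ge0//.
  by have /andP[] := clamp_diff T0W xy.
(* The Lipschitz bound is expressed in clamped times, so [q] takes equal values at times with the
   same clamp; in particular it is constant on each side of [0, T]. *)
have qclamp x : q x = q (clamp T x).
  have aux y z : y <= z -> clamp T y = clamp T z -> q y = q z.
    move=> yz cyz; apply/eqP; rewrite eq_sym -subr_eq0; apply/eqP/dot_eq0.
    have := qlip _ _ yz; rewrite cyz subrr mulr0 => h.
    by rewrite -sqr_enorm (@le_anti _ _ (enorm _) 0) ?expr0n// h enorm_ge0.
  have cc : clamp T (clamp T x) = clamp T x by rewrite clamp_id ?clamp_itv.
  by have [h|/ltW h] := leP x (clamp T x); [|symmetry]; apply: aux.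
exists q; split; [|by []|by []|].
- exact: (lipschitz_abs_continuous _ _ lipq).
- have aeF := ae_filter_ringOfSetsType (@lebesgue_measure R).
  have ae_der : {ae @lebesgue_measure R, forall t, 0 < t < T -> derivable q t 1}.
    (* There are finitely many entries, so their exceptional null sets can be united. *)
    have : \forall t \near almost_everywhere (@lebesgue_measure R),
        forall ij : 'I_N * 'I_2, 0 < t < T -> derivable (fun t => q t ij.1 ij.2) t 1.
      apply: filter_forall => -[i j] /=.
      apply: (@lipschitz_derivable_ae _ _ (2 * M)) => //.
      + move=> x y; wlog xy : x y / x <= y.
          by move=> H; have [/H//|/ltW/H] := leP x y; rewrite distrC [in leRHS]distrC.
        rewrite (ger0_norm (_ : 0 <= y - x)) ?subr_ge0//.
        by rewrite (le_trans _ (lipq _ _ xy))//; have := enorm_coord (q y - q x) i j; rewrite !mxE.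
      + by move=> x x0; rewrite qclamp clamp_le0// ltW.
      + by move=> x Tx; rewrite qclamp clamp_ge.
    by apply: filterS => t ht t0T; apply/derivable_mxP => i j; exact: (ht (i, j)).
  (* The inclusion is established at interior times only; the two endpoints are discarded as a null
     set. *)
  have ae_ends : {ae @lebesgue_measure R, forall t, t != 0 /\ t != T}.
    exists [set 0; T]; split.
    + by apply: measurableU; exact: measurable_set1.
    + apply: countable_lebesgue_measure0; apply: finite_set_countable.
      exact: finite_set2.
    + move=> t /= nt; have [->|t0] := eqVneq t 0; first by left.
      by have [->|tT] := eqVneq t T; [right|exfalso; apply: nt].
  move: ae_der ae_ends; apply: filterS2 => t dt [tn0 tnT] /andP[t0 tT].
  have t0T : 0 < t < T by rewrite !lt_neqAle eq_sym tn0 t0 tnT.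
  by split; [exact: dt|exact: (evi_normal_cone t0T (Qq t) (dt t0T) evi)].
Qed.

End evi_solution.

Unset Implicit Arguments.

Theorem theorem2p10 (R : realType) (N : nat) (hN : (0 < N)%N)
    (r : R) (hr : 0 < r)
    (U : 'M[R]_(N, 2) -> 'M[R]_(N, 2))
    (hUlip : elipschitz U) (hUbnd : ebounded U)
    (T : R) (hT : 0 < T) (q0 : 'M[R]_(N, 2)) (hq0 : feasible r q0) :
  (exists q : R -> 'M[R]_(N, 2), ac_solution r U T q0 q) /\
  (forall q1 q2 : R -> 'M[R]_(N, 2),
     ac_solution r U T q0 q1 -> ac_solution r U T q0 q2 ->
     forall t : R, 0 <= t <= T -> q1 t = q2 t).
Proof.
split; first exact: exists_ac_solution.
by move=> q1 q2; exact: ac_solution_unique.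
Qed.
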